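(* Let $1<p<\infty$. Let $\mathcal{G},\mathcal{V}:\mathcal{M}_p\to\mathbb{R}$ be continuous, with $\mathcal{G}$ Lipschitz continuous with respect to $W_p$, and suppose there are $\alpha,\beta\in\mathbb{R}$ and $\varrho\in\mathcal{M}_p$ such that $\mathcal{V}(\mu)\le\alpha W_p(\mu,\varrho)^p+\beta$ for all $\mu\in\mathcal{M}_p$. Suppose moreover that $\mathcal{G}$ and $\mathcal{V}$ are continuous with respect to the narrow topology on $\mathcal{P}_p(\mathbb{R}^d)$, and that $T>0$ satisfies $$p(2C_pT)^p\alpha<1,$$ where $C_p$ is the constant in the Poincaré inequality given in the context. Then for each $(\mu,t)\in\mathcal{M}_p\times[0,T)$, the value $$\mathcal{U}(\mu,t)=\inf\left\{\mathcal{G}(\sigma(0))+\int_0^t\left(\tfrac1p\|\dot\sigma(s)\|^p-\mathcal{V}(\sigma(s))\right)ds:\ \sigma\in AC_p([0,t],\mathcal{M}_p),\ \sigma(t)=\mu\right\}$$ has a minimizing path, i.e. the infimum is attained by some admissible $\sigma$.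
   Context: $\mathcal{M}_p$ is the set $\mathcal{P}_p(\mathbb{R}^d)$ of Borel probability measures on $\mathbb{R}^d$ with finite $p$-th moment, endowed with the $p$-Wasserstein metric $W_p$ (cost $|x-y|^p$). The narrow topology is the one induced by convergence against bounded continuous functions. $AC_p([0,t],\mathcal{M}_p)$ is the set of paths $\sigma:[0,t]\to\mathcal{M}_p$ for which there is $h\in L^p([0,t])$ with $W_p(\sigma(s_1),\sigma(s_2))\le\int_{s_1}^{s_2}h(u)\,du$ for all $0\le s_1\le s_2\le t$; the (a.e.) smallest such $h$ is denoted $\|\dot\sigma\|$ (metric derivative). $C_p>0$ is a fixed constant, depending only on $p$, for which the Poincaré inequality $$\left(\int_0^{T'}W_p(\sigma(t),\sigma(T'))^pdt\right)^{1/p}\le C_pT'\left(\int_0^{T'}\|\dot\sigma(t)\|^pdt\right)^{1/p}$$ holds for every $T'>0$ and every $\sigma\in AC_p([0,T'],\mathcal{M}_p)$ (such a constant exists). *)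

(* Defs.v *)
From HB Require Import structures.
From mathcomp Require Import all_boot all_order all_algebra.
From mathcomp Require Import all_classical all_reals all_analysis.

Set Implicit Arguments.
Unset Strict Implicit.
Unset Printing Implicit Defensive.

Import Order.TTheory GRing.Theory Num.Theory.
Import numFieldNormedType.Exports.

Local Open Scope classical_set_scope.
Local Open Scope ring_scope.

(* The library's norm on 'rV[R]_d is the sup norm; the transport cost uses the
   Euclidean one. Both induce the topology generating the Borel sets below. *)
Definition enorm (R : realType) (d : nat) (x : 'rV[R]_d) : R :=
  Num.sqrt (\sum_(i < d) x ord0 i ^+ 2).

Definition borel_rV (R : realType) (d : nat) :=
  g_sigma_algebraType (@open 'rV[R]_d).

Record Pp (R : realType) (d : nat) (p : R) := MkPp {
  law :> probability (borel_rV R d) R ;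
  finite_moment : (\int[law]_x (enorm (x : 'rV[R]_d) `^ p)%:E < +oo)%E }.
Arguments Pp {R} d p.

HB.instance Definition _ (R : realType) (d : nat) (p : R) :=
  gen_eqMixin (Pp d p).
HB.instance Definition _ (R : realType) (d : nat) (p : R) :=
  gen_choiceMixin (Pp d p).

Definition bounded_continuous (R : realType) (d : nat) :=
  {f : 'rV[R]_d -> R | continuous f /\ bounded_fun f}.

HB.instance Definition _ (R : realType) (d : nat) :=
  gen_eqMixin (bounded_continuous R d).
HB.instance Definition _ (R : realType) (d : nat) :=
  gen_choiceMixin (bounded_continuous R d).

Section Wasserstein.
Context (R : realType) (d : nat) (p : R).
Implicit Types mu nu : Pp d p.

Definition coupling mu nu :
    set (probability (borel_rV R d * borel_rV R d)%type R) :=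
  [set gamma | (forall A, measurable A -> gamma (A `*` setT) = mu A) /\
               (forall A, measurable A -> gamma (setT `*` A) = nu A)].

Definition transport_cost
    (gamma : probability (borel_rV R d * borel_rV R d)%type R) : \bar R :=
  (\int[gamma]_xy (enorm ((xy.1 : 'rV[R]_d) - xy.2) `^ p)%:E)%E.

(* The infimum is finite on Pp d p, so that [fine] loses nothing. *)
Definition Wp mu nu : R :=
  fine (ereal_inf [set transport_cost gamma | gamma in coupling mu nu])
    `^ p^-1.

Definition Wp_continuous (F : Pp d p -> R) : Prop :=
  forall mu e, 0 < e ->
    exists2 delta, 0 < delta &
      forall nu, Wp mu nu < delta -> `|F mu - F nu| < e.

Definition Wp_lipschitz (F : Pp d p -> R) : Prop :=
  exists L : R, forall mu nu, `|F mu - F nu| <= L * Wp mu nu.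

Definition integrals mu : {ptws bounded_continuous R d -> R} :=
  fun f => \int[mu]_x (sval f (x : 'rV[R]_d)).

(* the coarsest topology making mu |-> \int[mu]_x f x continuous for every
   bounded continuous f *)
Definition narrow := initial_topology integrals.

Definition narrow_continuous (F : Pp d p -> R) : Prop :=
  continuous (F : narrow -> R).

End Wasserstein.

(* A path [0, t] -> Pp d p is the restriction to [0, t] of a function
   sigma : R -> Pp d p; no definition below depends on sigma off [0, t]. *)
Section Paths.
Context (R : realType) (d : nat) (p : R).
Implicit Types (t : R) (sigma : R -> Pp d p) (h : R -> R).
Local Notation leb := (@lebesgue_measure R).

Definition Lp_on t h : Prop :=
  measurable_fun `[0, t] h /\
  (\int[leb]_(s in `[0%R, t]) (`|h s| `^ p)%:E < +oo)%E.

Definition speed_bound t sigma : set (R -> R) :=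
  [set h | Lp_on t h /\
    forall s1 s2, 0 <= s1 -> s1 <= s2 -> s2 <= t ->
      Wp (sigma s1) (sigma s2) <= \int[leb]_(u in `[s1, s2]) h u].

Definition AC t sigma : Prop := speed_bound t sigma !=set0.

Definition is_metric_derivative t sigma h : Prop :=
  speed_bound t sigma h /\
  forall k, speed_bound t sigma k ->
    {ae leb, forall s, s \in `[0, t] -> h s <= k s}.

(* A chosen representative of the a.e.-smallest speed bound; every
   path in AC t has one, so the default value 0 is only used outside AC t. *)
Definition metric_derivative t sigma : R -> R :=
  xget (cst 0) [set h | is_metric_derivative t sigma h].

Definition poincare_constant (C : R) : Prop :=
  0 < C /\
  forall t sigma, 0 < t -> AC t sigma ->
    ((\int[leb]_(s in `[0%R, t]) (Wp (sigma s) (sigma t) `^ p)%:E) `^ p^-1 <=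
     (C * t)%:E *
     (\int[leb]_(s in `[0%R, t])
        (`|metric_derivative t sigma s| `^ p)%:E) `^ p^-1)%E.

(* The absolute value only matters on a null set, where the representative may
   be negative. *)
Definition action (G V : Pp d p -> R) t sigma : \bar R :=
  ((G (sigma 0%R))%:E +
   \int[leb]_(s in `[0%R, t])
     (p^-1 * `|metric_derivative t sigma s| `^ p - V (sigma s))%:E)%E.

Definition admissible (mu : Pp d p) t : set (R -> Pp d p) :=
  [set sigma | AC t sigma /\ sigma t = mu].

Definition value (G V : Pp d p -> R) (mu : Pp d p) t : \bar R :=
  ereal_inf [set action G V t sigma | sigma in admissible mu t].

End Paths.
Arguments poincare_constant {R} d p C.

(* Main.v *)
(** The proof is the direct method, carried out along a nonprincipal ultrafilter
    [U] on [nat].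
    - Coercivity: [V] grows at most like [a * Wp ^ p], [G] is Lipschitz, and the
      Poincare inequality bounds the integral of [Wp (sigma s) mu ^ p] by the
      energy; smallness of [T] leaves a positive multiple [q] of the energy.
      Minimising sequences thus have bounded energy.
    - Compactness: bounded energy and the fixed endpoint [mu] bound the moments of
      all [sigma_n s], so that narrow ultralimits [sigma s] exist by Prokhorov.
      The ultralimit of the metric derivatives [g_n] is an [L^p] function [h] (the
      limit of the measures [A |-> \int_A g_n] has a density by
      Radon-Nikodym), and narrow lower semicontinuity of [Wp] shows that [h]
      bounds the speed of [sigma].
    - Lower semicontinuity: the energy is weakly lower semicontinuous, [G] passes
      to the narrow limit, and [V] does so uniformly in [s] because it is
      uniformly [Wp]-continuous on narrowly compact moment balls.
    The triangle inequality for [Wp] is never needed: a bound with a constant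
    [l > 1], obtained from product and near-optimal couplings, replaces it. *)
From HB Require Import structures.
From mathcomp Require Import all_boot all_order all_algebra.
From mathcomp Require Import all_classical all_reals all_analysis.
From mathcomp Require Import measurable_realfun finmap ring lra.
Require Import Defs.

Set Implicit Arguments.
Unset Strict Implicit.
Unset Printing Implicit Defensive.

Import Order.TTheory GRing.Theory Num.Theory.
Import numFieldNormedType.Exports.

Local Open Scope classical_set_scope.
Local Open Scope ring_scope.

(** * Ultralimits of tight families of probabilities *)

(** A limit has to be chosen at uncountably many times at once. Every bounded real family converges
    along an ultrafilter, so one [U] provides the limits at all times, of the energies and of the
    integrals over all measurable sets, with no diagonal extraction of subsequences.

    The factor 2 in the smallness condition pays for a change of centre: the growth of [V] is
    measured from [rho], the Poincare inequality from the endpoint [mu], and passing from one to the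
    other costs [2 ^ p] on the leading term. With [a] a positive number above [alpha], the action
    then controls the energy with the coefficient [p^-1 - a * (2 * C * T) ^ p], half of which is
    spent on the Lipschitz term [G (sigma 0)].

    Measurability in time of the distance along a path is never established. Integrals of that
    distance are therefore compared only as suprema over simple functions, and constants are moved
    in and out of the measurable side alone. *)

Lemma ultra_bounded_cvg (R : realType) (I : Type) (U : set_system I)
    {UU : UltraFilter U} (u : I -> R) (a b : R) :
  (forall i, a <= u i <= b) -> cvg (u @ U).
Proof.
move=> uab.
have [|x [_ clx]] := @segment_compact R a b (u @ U) _.
  by apply: nearW => i; rewrite /= in_itv/= uab.
apply/cvg_ex; exists x => N Nx.
(* If the preimage of [N] were not in [U], its complement would be, and [x] could not be a cluster
   point. *)
have [//|UN] := in_ultra_setVsetC (u @^-1` N) UU.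
by have [y [NCy]] := clx (~` N) N UN Nx; move/NCy.
Qed.

Section measure_probability.
Context (R : realType) d (T : measurableType d).
Variables (nu : {measure set T -> \bar R}) (nu1 : nu setT = 1%E).

Definition probability_of_measure of nu setT = 1%E : set T -> \bar R := nu.
Local Notation nuP := (probability_of_measure nu1).

HB.instance Definition _ := Measure.on nuP.
HB.instance Definition _ := Measure_isProbability.Build _ _ _ nuP nu1.

Lemma measure_probability : exists Q : probability T R, forall A, Q A = nu A.
Proof. by exists nuP. Qed.

End measure_probability.

Lemma probability_image (R : realType) d d' (T1 : measurableType d)
    (T2 : measurableType d') (P : {measure set T1 -> \bar R}) (f : T1 -> T2) :
  measurable_fun setT f -> P setT = 1%E ->
  exists Q : probability T2 R, forall A, Q A = P (f @^-1` A).
Proof.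
move=> mf P1.
pose nu : {measure set T2 -> \bar R} :=
  measure_function_pushforward__canonical__measure_function_Measure P mf.
have nu1 : nu setT = 1%E by rewrite /nu /= /pushforward preimage_setT.
by have [Q QE] := measure_probability nu1; exists Q => A; rewrite QE.
Qed.

(** Once open sets are Caratheodory measurable, the identity from the Caratheodory sigma-algebra to
    the Borel one is measurable; the image measure under it is the restriction to Borel sets. *)
Lemma caratheodory_probability (R : realType) (T : ptopologicalType)
    (mu : {outer_measure set T -> \bar R}) :
  mu setT = 1%E -> (forall O : set T, open O -> mu.-caratheodory O) ->
  exists Q : probability (g_sigma_algebraType (@open T)) R,
    forall A, Q A = mu A.
Proof.
move=> mu1 muO.
pose C := caratheodory_type mu; pose X := g_sigma_algebraType (@open T).
have mid : measurable_fun (setT : set C) (id : C -> X).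
  apply: (@measurability _ _ C X setT id (@open T)) => //.
  by move=> _ [ O oO <-]; rewrite setTI; exact: muO.
exact: (probability_image
  (P := (mu : set C -> \bar R) : {measure set C -> \bar R}) mid mu1).
Qed.

Section tight_limit.
Context (R : realType) (T : ptopologicalType).
Hypothesis (Thaus : hausdorff_space T) (Treg : regular_space T).
Local Notation X := (g_sigma_algebraType (@open T)).
Context (I : Type) (U : set_system I) (UU : UltraFilter U).
Variable P : I -> probability X R.
Hypothesis tightP : forall e : R, 0 < e ->
  exists2 K : set T, compact K & forall i, ((1 - e)%:E <= P i K)%E.

Let m (A : set T) : R := lim ((fun i => fine (P i A)) @ U).

Lemma prob_fine01 (Q : probability X R) (A : set X) :
  measurable A -> 0 <= fine (Q A) <= 1.
Proof.
move=> mA; rewrite fine_ge0 ?measure_ge0//=.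
have := probability_le1 Q mA.
by rewrite -[in X in (X <= _)%E -> _](fineK (fin_num_measure Q _ mA)) lee_fin.
Qed.

Let m_cvg (A : set X) : measurable A -> (fun i => fine (P i A)) @ U --> m A.
Proof.
move=> mA; apply: (@ultra_bounded_cvg R I U UU _ 0 1) => i.
exact: prob_fine01.
Qed.

Let m_ge0 (A : set X) : measurable A -> 0 <= m A.
Proof.
move=> mA; apply: (cvgr_to_ge (m_cvg mA)).
by apply: nearW => i; case/andP: (prob_fine01 (P i) mA).
Qed.

Let m_le1 (A : set X) : measurable A -> m A <= 1.
Proof.
move=> mA; apply: (cvgr_to_le (m_cvg mA)).
by apply: nearW => i; case/andP: (prob_fine01 (P i) mA).
Qed.

Let mU (A B : set X) : measurable A -> measurable B -> A `&` B = set0 ->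
  m (A `|` B) = m A + m B.
Proof.
move=> mA mB AB0; apply: cvg_lim => //.
rewrite (_ : (fun i => _) = (fun i => fine (P i A)) + (fun i => fine (P i B))).
  exact: cvgD (m_cvg mA) (m_cvg mB).
apply/funext => i; rewrite measureU//= fineD//; exact: fin_num_measure.
Qed.

Let le_m (A B : set X) : measurable A -> measurable B -> A `<=` B -> m A <= m B.
Proof.
move=> mA mB AB; rewrite -(setDUK AB) mU//; last 2 first.
- exact: measurableD.
- by rewrite setDE setICA setICr setI0.
by rewrite lerDl m_ge0//; exact: measurableD.
Qed.

Let mU_le (A B : set X) : measurable A -> measurable B -> m (A `|` B) <= m A + m B.
Proof.
move=> mA mB; rewrite -(setDUK (@subsetUl _ A B)) mU//; last 2 first.
- by apply: measurableD => //; exact: measurableU.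
- by rewrite setDE setICA setICr setI0.
rewrite lerD2l; apply: le_m => //; first by apply: measurableD => //; exact: measurableU.
by move=> x [[]].
Qed.

Lemma open_borel (A : set T) : open A -> measurable (A : set X).
Proof. by move=> oA; exact: sub_sigma_algebra. Qed.

Lemma closed_borel (A : set T) : closed A -> measurable (A : set X).
Proof.
move=> cA; rewrite -(setCK A); apply: measurableC; apply: open_borel.
exact: closed_openC.
Qed.

Let compact_borel (A : set T) : compact A -> measurable (A : set X).
Proof. by move=> cA; apply: closed_borel; exact: compact_closed. Qed.

Let lam (O : set T) : \bar R :=
  ereal_sup [set (m K)%:E | K in [set K | compact K /\ K `<=` O]].

Let le_lam (A B : set T) : A `<=` B -> (lam A <= lam B)%E.
Proof.
move=> AB; apply: ge_ereal_sup => _ [K [cK KA] <-].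
by apply: ereal_sup_ubound; exists K => //; split=> //; exact: subset_trans AB.
Qed.

Let lam_ge0 (A : set T) : (0 <= lam A)%E.
Proof.
apply: (@le_trans _ _ (m set0)%:E); first by rewrite lee_fin m_ge0.
by apply: ereal_sup_ubound; exists set0 => //; split => //; exact: compact0.
Qed.

Let lam_le1 (A : set T) : (lam A <= 1)%E.
Proof.
apply: ge_ereal_sup => _ [K [cK KA] <-].
by rewrite lee_fin; apply: m_le1; exact: compact_borel.
Qed.

Let lam_le (A : set T) : open A -> (lam A <= (m A)%:E)%E.
Proof.
move=> oA; apply: ge_ereal_sup => _ [K [cK KA] <-].
by rewrite lee_fin; apply: le_m => //; [exact: compact_borel|exact: open_borel].
Qed.

(** By regularity each point of a compact [K] has a neighbourhood whose closure lies in one of the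
    [O k]. Finitely many of these cover [K]; grouped by [k] they cut it into compact pieces [C k]
    inside [O k], and finite subadditivity of [m] suffices. *)
Let lam_bigcup (O : (set T)^nat) : (forall k, open (O k)) ->
  (lam (\bigcup_k O k) <= \sum_(k <oo) lam (O k))%E.
Proof.
move=> oO; apply: ge_ereal_sup => _ [K [cK KO] <-].
have : cover_compact K by rewrite -compact_cover.
pose D : set (set T * nat) := [set p | open p.1 /\ closure p.1 `<=` O p.2].
move=> /(_ _ D fst)[|x Kx|D' D'D KD'].
- by move=> p [].
- have [k _ Okx] := KO x Kx.
  have [|V Vx VO] := @Treg x (O k); first by apply: open_nbhs_nbhs; split.
  exists (V°, k); last by rewrite /=; exact: Vx.
  split => /=; first exact: open_interior.
  by apply: subset_trans VO; apply: closure_subset; exact: interior_subset.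
pose C k := K `&` \bigcup_(p in [set p | p \in D' /\ p.2 = k]) closure p.1.
have cC k : compact (C k).
  apply: compact_closedI => //; apply: closed_bigcup => [|p _]; last first.
    exact: closed_closure.
  by apply: (sub_finite_set _ (finite_fset D')) => p /= [].
have CO k : C k `<=` O k.
  move=> x [_ [p /= [pD' <-]]]; have /D'D := pD'.
  by move=> /set_mem[_]; apply.
pose N := (\max_(p <- D') p.2).+1.
have KC : K `<=` \big[setU/set0]_(k < N) C k.
  move=> x Kx; have [p /= pD' px] := KD' x Kx.
  rewrite -bigcup_mkord; exists p.2.
    by rewrite /= ltnS; exact: (leq_bigmax_seq (F := snd)) pD' _.
  by split => //; exists p => //; exact: subset_closure.
have mCn n : measurable (\big[setU/set0]_(k < n) C k : set X).
  by apply: bigsetU_measurable => k _; exact: compact_borel.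
have mS n : m (\big[setU/set0]_(k < n) C k) <= \sum_(k < n) m (C k).
  elim: n => [|n IHn].
    rewrite !big_ord0; have := @mU set0 set0 measurable0 measurable0 (setI0 _).
    by rewrite setU0; lra.
  rewrite !big_ord_recr/=; apply: le_trans (lerD IHn (lexx _)).
  exact: mU_le (mCn n) (compact_borel (cC n)).
apply: (@le_trans _ _ (\sum_(k < N) lam (O k))%E); last first.
  rewrite -(big_mkord xpredT (fun k => lam (O k))).
  by apply: nneseries_lim_ge => k *; exact: lam_ge0.
apply: (@le_trans _ _ (\sum_(k < N) m (C k))%:E).
  by rewrite lee_fin; apply: le_trans (mS N); exact: le_m (compact_borel cK) (mCn N) KC.
rewrite -sumEFin; apply: lee_sum => k _; apply: ereal_sup_ubound.
by exists (C k).
Qed.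

(* The ultralimit [m] is only finitely additive; imposing inner regularity by
   compact sets on the open sets restores countable subadditivity. *)
Definition tight_outer_measure (A : set T) : \bar R :=
  ereal_inf [set lam O | O in [set O | open O /\ A `<=` O]].
Local Notation mus := tight_outer_measure.

Let mus_ge0 A : (0 <= mus A)%E.
Proof. by apply: le_ereal_inf_tmp => _ [ O _ <-]; exact: lam_ge0. Qed.

Let mus_open O : open O -> mus O = lam O.
Proof.
move=> oO; apply/eqP; rewrite eq_le; apply/andP; split.
  by apply: ereal_inf_lbound; exists O => //; split.
by apply: le_ereal_inf_tmp => _ [ O' [_ OO'] <-]; exact: le_lam.
Qed.

Let mus0 : mus set0 = 0%E.
Proof.
apply/eqP; rewrite eq_le mus_ge0 andbT mus_open; last exact: open0.
apply: ge_ereal_sup => _ [K [_ K0] <-]; rewrite (_ : K = set0); last by apply/seteqP; split.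
have := @mU set0 set0 measurable0 measurable0 (setI0 _).
by rewrite setU0 lee_fin; lra.
Qed.

Let le_mus : {homo mus : A B / A `<=` B >-> (A <= B)%E}.
Proof.
move=> A B AB; apply: le_ereal_inf_tmp => _ [ O [oO BO] <-].
by apply: ereal_inf_lbound; exists O => //; split => //; exact: subset_trans BO.
Qed.

Let mus_fin A : mus A \is a fin_num.
Proof.
rewrite ge0_fin_numE//; apply: (@le_lt_trans _ _ 1%E); last by rewrite ltry.
apply: (@le_trans _ _ (lam setT)) => //; apply: ereal_inf_lbound.
by exists setT => //; split => //; exact: openT.
Qed.

Let mus_subadd : sigma_subadditive mus.
Proof.
move=> F; apply/lee_addgt0Pr => e e0.
have h k : {O | (open O /\ F k `<=` O) /\
   (lam O <= mus (F k) + (e / (2 ^ k.+1)%:R)%:E)%E}.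
  apply: cid.
  have ek : 0 < e / (2 ^ k.+1)%:R :> R by rewrite divr_gt0// ltr0n expn_gt0.
  have [_ [ O oFO <-] lO] := lb_ereal_inf_adherent ek (mus_fin (F k)).
  by exists O; split => //; exact: ltW.
pose O k := sval (h k).
have oO k : open (O k) by case: (svalP (h k)) => -[].
apply: (@le_trans _ _ (lam (\bigcup_k O k))).
  apply: ereal_inf_lbound; exists (\bigcup_k O k) => //; split.
    exact: bigcup_open.
  by apply: subset_bigcup => k _; case: (svalP (h k)) => -[].
apply: (le_trans (lam_bigcup oO)).
apply: (le_trans _ (epsilon_trick _ _ _)); last 2 first.
- by move=> k; exact: mus_ge0.
- exact: ltW.
by apply: lee_nneseries => [k _ _|k _]; [exact: lam_ge0|case: (svalP (h k))].
Qed.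

HB.instance Definition _ := isOuterMeasure.Build R T mus
  mus0 mus_ge0 le_mus mus_subadd.

(** For an open [G] containing [A], take a compact [K] in the intersection of [G] and [O] that
    almost exhausts its content. The open set [G] minus [K] contains [A] minus [O], and its compact
    subsets are disjoint from [K], so the contents add up to at most that of [G]. *)
Let cara_open O : open O -> mus.-caratheodory O.
Proof.
move=> oO; apply: le_caratheodory_measurable => A.
apply: le_ereal_inf_tmp => _ [G [oG AG] <-].
apply/lee_addgt0Pr => e e0.
have lfin : lam (G `&` O) \is a fin_num.
  by rewrite -mus_open//; exact: openI.
have [_ [K [cK KGO] <-] mK] := ub_ereal_sup_adherent e0 lfin.
have oGK : open (G `\` K).
  by apply: openI => //; apply: closed_openC; exact: compact_closed.
apply: (@le_trans _ _ (lam (G `&` O) + lam (G `\` K))%E).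
  apply: leeD; apply: ereal_inf_lbound.
    exists (G `&` O) => //; split; first exact: openI.
    exact: setSI.
  exists (G `\` K) => //; split => // x [Ax nOx]; split; first exact: AG.
  by move=> /KGO[].
have lGK : (lam (G `\` K) <= lam G - (m K)%:E)%E.
  apply: ge_ereal_sup => _ [K' [cK' K'GK] <-].
  rewrite leeBrDr// -EFinD -mU; [|exact: compact_borel|exact: compact_borel|].
    apply: ereal_sup_ubound; exists (K' `|` K) => //; split.
      exact: compactU.
    by move=> x [/K'GK[]//|/KGO[]].
  by apply/seteqP; split => // x [/K'GK[]].
have mK' : (lam (G `&` O) - e%:E <= (m K)%:E)%E := ltW mK.
have Gfin : lam G \is a fin_num by rewrite -mus_open.
have GKfin : lam (G `\` K) \is a fin_num by rewrite -mus_open.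
move: mK' lGK; rewrite -(fineK lfin) -(fineK Gfin) -(fineK GKfin).
by rewrite -!EFinB -!EFinD !lee_fin; lra.
Qed.

(** Tightness enters here: the compact sets retain mass at least [1 - e] in the ultralimit, so no
    mass escapes. *)
Let mus_setT : mus setT = 1%E.
Proof.
apply/eqP; rewrite eq_le mus_open; last exact: openT.
rewrite lam_le1/=; apply/lee_addgt0Pr => e e0.
have [K cK PK] := tightP e0.
rewrite -leeBlDr// -EFinB; apply: (@le_trans _ _ (m K)%:E); last first.
  by apply: ereal_sup_ubound; exists K.
have mK := compact_borel cK.
rewrite lee_fin; apply: (cvgr_to_ge (m_cvg mK)); apply: nearW => i.
by rewrite -lee_fin fineK ?PK// fin_num_measure.
Qed.

(** On an open set the measure is a supremum of [m] over compact subsets, hence at most [m]. This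
    one-sided bound is what the portmanteau theorem asks for. *)
Lemma tight_ultra_open : exists Q : probability X R,
  forall O : set T, open O -> fine (Q O) <= lim ((fun i => fine (P i O)) @ U).
Proof.
have [Q QE] := caratheodory_probability mus_setT cara_open.
exists Q => O oO; have -> : Q O = lam O by rewrite QE; exact: mus_open.
rewrite -lee_fin fineK; first exact: lam_le.
by rewrite -mus_open.
Qed.

End tight_limit.

Lemma le_filter_lim (R : realType) (I : Type) (F : set_system I)
    {FF : ProperFilter F} (u v : I -> R) (a b : R) :
  u @ F --> a -> v @ F --> b -> (forall i, u i <= v i) -> a <= b.
Proof.
move=> ua vb uv; rewrite -subr_ge0.
by apply: (cvgr_to_ge (cvgB vb ua)); apply: nearW => i; rewrite !fctE subr_ge0.
Qed.

Lemma continuous_borel_fun (R : realType) (T : ptopologicalType) (f : T -> R) :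
  continuous f ->
  measurable_fun setT (f : g_sigma_algebraType (@open T) -> R).
Proof.
move=> cf; apply: (measurability _ (measurable_realfun.RGenOpens.measurableE R)).
move=> _ [_ [a [b ->] <-]]; rewrite setTI; apply: open_borel.
by move/continuousP : cf; apply; exact: interval_open.
Qed.

(** * Portmanteau theorem *)

Section probability_integrals.
Context (R : realType) d (X : measurableType d).
Implicit Types P : probability X R.

Lemma bounded_integrable P (f : X -> R) (B : R) :
  measurable_fun setT f -> (forall x, `|f x| <= B) ->
  P.-integrable setT (EFin \o f).
Proof.
move=> mf fB; apply: measurable_bounded_integrable => //.
  by rewrite -ge0_fin_numE// fin_num_measure.
exists B; split; first exact: num_real.
by move=> M BM x _ /=; apply: le_trans (fB x) _; exact: ltW.
Qed.

Lemma Rintegral_prob_cst P (e : R) : \int[P]_x e = e.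
Proof.
rewrite Rintegral_cst// [X in fine X](_ : _ = 1%E) ?mulr1//.
exact: probability_setT.
Qed.

Lemma Rintegral_indic P (A : set X) : measurable A ->
  \int[P]_x (\1_A x) = fine (P A).
Proof. by move=> mA; rewrite /Rintegral integral_indic// setIT. Qed.

Let indic_sum_le (A : nat -> set X) N x :
  `|\sum_(k < N) (\1_(A k) x : R)| <= N%:R.
Proof.
rewrite ger0_norm; last by apply: sumr_ge0 => k _; rewrite indicE ler0n.
rewrite -[leRHS](_ : \sum_(k < N) (1 : R) = _); last first.
  by rewrite big_const_ord iter_addr_0.
by apply: ler_sum => k _; rewrite indicE; case: (_ \in _); rewrite /= ?ler01.
Qed.

Let indic_sum_measurable (A : nat -> set X) N : (forall k, measurable (A k)) ->
  measurable_fun setT (fun x => \sum_(k < N) (\1_(A k) x : R)).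
Proof. by move=> mA; apply: measurable_sum => k; exact: measurable_indic. Qed.

Lemma integrable_indic_sum P (A : nat -> set X) N :
  (forall k, measurable (A k)) ->
  P.-integrable setT (EFin \o (fun x => \sum_(k < N) (\1_(A k) x : R))).
Proof.
move=> mA; apply: (bounded_integrable _ (B := N%:R)).
  exact: indic_sum_measurable.
by move=> x; exact: indic_sum_le.
Qed.

Lemma Rintegral_indic_sum P (A : nat -> set X) N :
  (forall k, measurable (A k)) ->
  \int[P]_x (\sum_(k < N) \1_(A k) x) = \sum_(k < N) fine (P (A k)).
Proof.
move=> mA; elim: N => [|N IHN].
  under eq_Rintegral do rewrite big_ord0.
  by rewrite big_ord0 Rintegral_cst// mul0r.
under eq_Rintegral do rewrite big_ord_recr/=.
rewrite big_ord_recr/= RintegralD//; last 2 first.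
- exact: integrable_indic_sum.
- exact: integrable_indic.
by rewrite IHN Rintegral_indic.
Qed.

(** The sum counts the first [N] positive multiples of [e] that lie strictly below [y]. Times [e] it
    rounds [y] down, and [le_layer_sum] bounds the rounding error by [e]. *)
Lemma layer_sum_le (y e : R) N : 0 < e -> 0 <= y ->
  e * \sum_(k < N) (k.+1%:R * e < y)%R%:R <= y.
Proof.
move=> e0 y0.
(* The extra bound by [M * e] closes the induction: if the next level [M.+1 * e] is below [y], the
   sum may grow by one more [e] without passing [y]. *)
suff H M : e * \sum_(k < M) (k.+1%:R * e < y)%R%:R <= Num.min y (M%:R * e).
  by apply: le_trans (H N) _; rewrite ge_min lexx.
elim: M => [|M IHM]; first by rewrite big_ord0 mulr0 mul0r le_min y0 lexx.
rewrite big_ord_recr/= mulrDr; move: IHM; rewrite !le_min => /andP[IH1 IH2].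
have M0 : 0 <= M%:R :> R by [].
have S : M.+1%:R = M%:R + 1 :> R by rewrite -natr1.
by rewrite S in IH1 IH2 *; case: ltP => /= hy; apply/andP; split; nra.
Qed.

Lemma le_layer_sum (y e : R) N : 0 < e -> y <= N%:R * e ->
  y <= e + e * \sum_(k < N) (k.+1%:R * e < y)%R%:R.
Proof.
move=> e0 yN.
suff H M : Num.min y (M.+1%:R * e) <= e + e * \sum_(k < M) (k.+1%:R * e < y)%R%:R.
  apply: le_trans (H N); rewrite le_min lexx (le_trans yN)// ler_pM2r//.
  by rewrite ler_nat.
elim: M => [|M IHM]; first by rewrite big_ord0 mulr0 addr0 mul1r ge_min lexx orbT.
rewrite big_ord_recr/= mulrDr addrA; move: IHM.
have S : M.+2%:R = M.+1%:R + 1 :> R by rewrite -natr1.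
rewrite S !ge_min mulrDl mul1r; case: ltP => /= hy /orP[h|h]; apply/orP; 
  solve [left; lra|right; lra].
Qed.

(** A layer-cake formula with finitely many levels. It reduces integrals to measures of superlevel
    sets, open for continuous [f], with an error [e] that does not depend on [P]. *)
Lemma Rintegral_layer P (f : X -> R) (e : R) N : 0 < e ->
  measurable_fun setT f -> (forall x, 0 <= f x <= N%:R * e) ->
  let S := e * \sum_(k < N) fine (P [set x | k.+1%:R * e < f x]) in
  S <= \int[P]_x f x <= e + S.
Proof.
move=> e0 mf f0; pose A (k : nat) := [set x | k.+1%:R * e < f x].
have mA k : measurable (A k).
  rewrite /A -[X in measurable X]setTI.
  rewrite (_ : [set x | _] = f @^-1` `]k.+1%:R * e, +oo[); first exact: mf.
  by apply/seteqP; split => x /=; rewrite in_itv/= andbT.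
have fi : P.-integrable setT (EFin \o f).
  apply: (bounded_integrable _ (B := N%:R * e)) => // x.
  by have /andP[? ?] := f0 x; rewrite ger0_norm.
have Si := integrable_indic_sum P N mA.
have eSi : P.-integrable setT (EFin \o (fun x => e * \sum_(k < N) (\1_(A k) x : R))).
  by rewrite (_ : _ \o _ = (fun x => e%:E * (\sum_(k < N) (\1_(A k) x : R))%:E)%E);
    [exact: integrableZl|apply/funext => x; rewrite /= EFinM].
have iA k x : \1_(A k) x = (k.+1%:R * e < f x)%R%:R :> R.
  by rewrite indicE; congr (nat_of_bool _)%:R; apply/idP/idP => [/set_mem|?]; rewrite ?mem_set.
rewrite /= -(Rintegral_indic_sum P N mA) -RintegralZl//; apply/andP; split.
  apply: le_Rintegral => // x _.
  under eq_bigr do rewrite iA.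
  by apply: layer_sum_le => //; case/andP: (f0 x).
rewrite -[X in _ <= X + _](_ : \int[P]_x e = e); last first.
  exact: Rintegral_prob_cst.
have ei : P.-integrable setT (EFin \o cst e) by exact: finite_measure_integrable_cst.
rewrite -RintegralD//; apply: le_Rintegral => //.
  by rewrite (_ : _ \o _ = (fun x => (cst e x)%:E + (e * \sum_(k < N) (\1_(A k) x : R))%:E)%E);
    [exact: integrableD|apply/funext => x; rewrite /= EFinD].
move=> x _; under eq_bigr do rewrite iA.
by apply: le_layer_sum => //; case/andP: (f0 x).
Qed.

End probability_integrals.

Section borel_probability.
Context (R : realType) (T : ptopologicalType).
Local Notation X := (g_sigma_algebraType (@open T)).

Lemma Rintegral_bound (P : probability X R) (f : T -> R) (B : R) :
  continuous f -> (forall x, `|f x| <= B) -> - B <= \int[P]_x f x <= B.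
Proof.
move=> cf fB; have mf := continuous_borel_fun cf.
have fi := bounded_integrable P mf fB.
rewrite -ler_norml; apply: le_trans (le_normr_Rintegral _ fi) _ => //.
rewrite -[leRHS](Rintegral_prob_cst P); apply: le_Rintegral => //.
  by apply: (bounded_integrable P (B := B)) => [|x]; [exact: measurableT_comp|rewrite normr_id].
exact: finite_measure_integrable_cst.
Qed.

(** Through the layer sums the hypothesis on open sets yields one inequality for nonnegative [f].
    Applied to [B + f] and to [B - f], it yields both. *)
Lemma portmanteau_ultra (I : Type) (U : set_system I) (UU : UltraFilter U)
    (P : I -> probability X R) (Q : probability X R) :
  (forall O : set T, open O -> fine (Q O) <= lim ((fun i => fine (P i O)) @ U)) ->
  forall (f : T -> R) (B : R), continuous f -> (forall x, `|f x| <= B) ->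
  (fun i => \int[P i]_x f x) @ U --> \int[Q]_x f x.
Proof.
move=> PQ.
have cvgf (f : T -> R) (B : R) : continuous f -> (forall x, `|f x| <= B) ->
    cvg ((fun i => \int[P i]_x f x) @ U).
  move=> cf fB; apply: (@ultra_bounded_cvg R I U UU _ (- B) B) => i.
  exact: Rintegral_bound.
have key (f : T -> R) (B : R) : continuous f -> (forall x, 0 <= f x <= B) ->
    \int[Q]_x f x <= lim ((fun i => \int[P i]_x f x) @ U).
  move=> cf fB.
  have fB' x : `|f x| <= B by have /andP[? ?] := fB x; rewrite ger0_norm.
  apply/ler_addgt0Pr => e e0; pose N := (Num.truncn (B / e)).+1.
  have BN : B <= N%:R * e by rewrite -ler_pdivrMr// ltW// truncnS_gt.
  have fN x : 0 <= f x <= N%:R * e.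
    by have /andP[-> h] := fB x; exact: le_trans BN.
  have mf := continuous_borel_fun cf.
  pose A (k : nat) := [set x : T | k.+1%:R * e < f x].
  have oA k : open (A k).
    rewrite (_ : A k = f @^-1` `]k.+1%:R * e, +oo[); last first.
      by apply/seteqP; split => x /=; rewrite in_itv/= andbT.
    by move/continuousP : cf; apply; exact: interval_open.
  have cA k : (fun i => fine (P i (A k))) @ U --> lim ((fun i => fine (P i (A k))) @ U).
    apply: (@ultra_bounded_cvg R I U UU _ 0 1) => i.
    by apply: prob_fine01; exact: open_borel.
  have cS : (fun i => e * \sum_(k < N) fine (P i (A k))) @ U -->
      e * \sum_(k < N) lim ((fun i => fine (P i (A k))) @ U).
    by apply: cvgMl_tmp; apply: cvg_big => //; exact: add_continuous.
  have /andP[_ Qf] := Rintegral_layer Q e0 mf fN.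
  apply: (le_trans Qf); rewrite addrC lerD2r.
  apply: (@le_trans _ _ (e * \sum_(k < N) lim ((fun i => fine (P i (A k))) @ U))).
    rewrite ler_pM2l//; apply: ler_sum => k _.
    exact: PQ (oA k).
  apply: (le_filter_lim cS (cvgf _ _ cf fB')) => i.
  by have /andP[] := Rintegral_layer (P i) e0 mf fN.
move=> f B cf fB.
suff -> : \int[Q]_x f x = lim ((fun i => \int[P i]_x f x) @ U) by exact: (cvgf f B).
have shift (P' : probability X R) (g : T -> R) : continuous g ->
    (forall x, `|g x| <= B) -> \int[P']_x (B + g x) = B + \int[P']_x g x.
  move=> cg gB; rewrite (RintegralD (f1 := cst B))//.
  - by rewrite Rintegral_prob_cst.
  - exact: finite_measure_integrable_cst.
  - by apply: (bounded_integrable P' _ gB); exact: continuous_borel_fun.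
have half (g : T -> R) : continuous g -> (forall x, `|g x| <= B) ->
    \int[Q]_x g x <= lim ((fun i => \int[P i]_x g x) @ U).
  move=> cg gB; rewrite -(lerD2l B) -shift//.
  have cBg : continuous (fun x => B + g x).
    by move=> x; apply: (@cvgD _ _ _ _ _ (cst B) g); [exact: cvg_cst|exact: cg].
  apply: le_trans (key _ (B + B) cBg _) _.
    by move=> x; have := gB x; rewrite ler_norml => /andP[? ?]; apply/andP; split; lra.
  rewrite (_ : (fun i => _) = (cst B + (fun i => \int[P i]_x g x))); last first.
    by apply/funext => i; rewrite shift.
  by rewrite limD ?lim_cst//; [exact: cvg_cst|exact: (cvgf g B)].
apply/eqP; rewrite eq_le half//=.
have cNf : continuous (fun x => - f x) by move=> x; apply: cvgN; exact: cf.
have NfB x : `|- f x| <= B by rewrite normrN.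
have intN (P' : probability X R) : \int[P']_x (- f x) = - \int[P']_x f x.
  rewrite -[RHS]mulN1r -RintegralZl//.
    by apply: eq_Rintegral => x _; rewrite mulN1r.
  by apply: (bounded_integrable P' _ fB); exact: continuous_borel_fun.
have := half _ cNf NfB; rewrite intN.
rewrite (_ : (fun i => _) = (- (fun i => \int[P i]_x f x))); last first.
  by apply/funext => i; rewrite intN.
by rewrite limN ?lerN2//; exact: (cvgf f B).
Qed.

End borel_probability.

(** * Borel probabilities are determined by bounded continuous functions *)

Section uniqueness.
Context (R : realType) (V : normedModType R).
Local Notation X := (g_sigma_algebraType (@open V)).

Let dist (F : set V) (x : V) : R := inf [set `|x - y| | y in F].

Let dist_ge0 F x : F !=set0 -> 0 <= dist F x.
Proof.
move=> [y Fy]; apply: lb_le_inf; first by exists `|x - y|, y.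
by move=> _ [z _ <-].
Qed.

Let dist_le F x y : F y -> dist F x <= `|x - y|.
Proof.
move=> Fy; apply: ge_inf; last by exists y.
by exists 0 => _ [z _ <-].
Qed.

Let dist_lip F x y : F !=set0 -> dist F x <= dist F y + `|x - y|.
Proof.
move=> F0; rewrite -lerBlDr; apply: lb_le_inf.
  by case: F0 => z Fz; exists `|y - z|, z.
move=> _ [z Fz <-]; rewrite lerBlDr; apply: le_trans (dist_le _ Fz) _.
by rewrite [leRHS]addrC -(subrKA y x (- z)); exact: ler_normD.
Qed.

Let dist_continuous F : F !=set0 -> continuous (dist F).
Proof.
move=> F0 x; apply/cvgrPdist_le => e e0; near=> y.
apply: (@le_trans _ _ `|x - y|); last first.
  by near: y; apply: cvgr_dist_le => //; exact: cvg_id.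
have := dist_lip x y F0; have := dist_lip y x F0.
by rewrite (distrC y x) ler_norml => ? ?; apply/andP; split; lra.
Unshelve. all: by end_near. Qed.

(** Open sets form a generating pi-system, so equality on them suffices. For open [O] the cut-offs
    [f k] of the distance to the complement lie between the indicators of [A k] and of [O], and the
    [A k] increase to [O]. *)
Lemma bounded_continuous_eq (P Q : probability X R) :
  (forall f : V -> R, continuous f -> bounded_fun f ->
    \int[P]_x f x = \int[Q]_x f x) ->
  forall A, measurable A -> P A = Q A.
Proof.
move=> PQ.
have half (P1 P2 : probability X R) (O : set V) :
    (forall f : V -> R, continuous f -> bounded_fun f ->
      \int[P1]_x f x = \int[P2]_x f x) ->
    open O -> (P1 O <= P2 O)%E.
  move=> P12 oO; have mO : measurable (O : set X) by exact: open_borel.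
  (* If the complement of [O] is empty, [dist] is an infimum over the empty set and says nothing;
     that case is settled by total mass. *)
  have [F0|] := pselect ((~` O) !=set0); last first.
    move=> /set0P/negP; rewrite negbK => /eqP OT.
    by rewrite -(setCK O) OT setC0 !probability_setT.
  pose f k x : R := Num.min 1 (k.+1%:R * dist (~` O) x).
  pose A k : set V := [set x | 1 < k.+1%:R * dist (~` O) x].
  have cd k : continuous (fun x => k.+1%:R * dist (~` O) x).
    by move=> x; apply: cvgMl_tmp; exact: dist_continuous.
  have cf k : continuous (f k).
    by move=> x; apply: (@continuous_min _ _ (cst 1) _ x); [exact: cvg_cst|exact: cd].
  have f01 k x : 0 <= f k x <= 1.
    by rewrite /f le_min ler01 ge_min lexx mulr_ge0// dist_ge0.
  have f1 k x : `|f k x| <= 1 by have /andP[? ?] := f01 k x; rewrite ger0_norm.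
  have oA k : open (A k).
    rewrite (_ : A k = (fun x => k.+1%:R * dist (~` O) x) @^-1` `]1, +oo[); last first.
      by apply/seteqP; split => x /=; rewrite in_itv/= andbT.
    by move/continuousP : (cd k); apply; exact: interval_open.
  have mA k : measurable (A k : set X) by exact: open_borel.
  have OA : \bigcup_k A k = O.
    apply/seteqP; split => [x [k _] Ax|x Ox].
      apply: contrapT => nOx; move: Ax; rewrite /A /=.
      have := @dist_le (~` O) x x nOx; rewrite subrr normr0 => d0.
      suff -> : dist (~` O) x = 0 by rewrite mulr0 ltr10.
      by apply/eqP; rewrite eq_le d0 dist_ge0.
    have /nbhs_ballP[e /= e0 Oe] : nbhs x O by exact: open_nbhs_nbhs.
    have de : e <= dist (~` O) x.
      apply: lb_le_inf; first by case: F0 => z Fz; exists `|x - z|, z.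
      move=> _ [z nOz <-]; rewrite leNgt; apply/negP => xz; apply: nOz.
      by apply: Oe; rewrite -ball_normE.
    exists (Num.truncn e^-1) => //; rewrite /A /=.
    apply: (@lt_le_trans _ _ ((Num.truncn e^-1).+1%:R * e)); last by rewrite ler_pM2l.
    by rewrite -ltr_pdivrMr// div1r truncnS_gt.
  have cA : P1 (A k) @[k --> \oo] --> P1 O.
    rewrite -OA; apply: nondecreasing_cvg_mu => //; first by rewrite OA.
    move=> m n mn; apply/subsetPset => x; rewrite /A /= => /lt_le_trans; apply.
    by rewrite ler_wpM2r ?dist_ge0// ler_nat.
  rewrite -(cvg_lim _ cA)//; apply: lime_le; first by apply/cvg_ex; exists (P1 O).
  apply: nearW => k.
  rewrite -(fineK (fin_num_measure P1 _ (mA k))) -(fineK (fin_num_measure P2 _ mO)) lee_fin.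
  rewrite -!Rintegral_indic//.
  have fi Q' := bounded_integrable Q' (continuous_borel_fun (cf k)) (f1 k).
  apply: (@le_trans _ _ (\int[P1]_x f k x)).
    apply: le_Rintegral => //; [exact: integrable_indic|exact: fi|].
    move=> x _; rewrite indicE; case: (boolP (x \in A k)) => [/set_mem Ax|_] /=.
      by rewrite /f le_min lexx ltW.
    by case/andP: (f01 k x).
  rewrite P12//; last first.
    by exists 1; split; [exact: num_real|move=> M M1 x _; exact: le_trans (f1 k x) (ltW M1)].
  apply: le_Rintegral => //; [exact: fi|exact: integrable_indic|].
  move=> x _; rewrite indicE; case: (boolP (x \in O)) => [_|/negP nOx] /=.
    by case/andP: (f01 k x).
  have {}nOx : ~ O x by move=> Ox; apply: nOx; rewrite mem_set.
  have := @dist_le (~` O) x x nOx; rewrite subrr normr0 => d0.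
  by rewrite /f ge_min; apply/orP; right; rewrite mulr_ge0_le0.
apply: (@measure_unique _ R X (@open V) (fun=> setT)) => //.
- by move=> A B; exact: openI.
- by move=> _; exact: openT.
- by rewrite bigcup_const//; exists 0%N.
- move=> O oO; apply/eqP; rewrite eq_le; apply/andP; split; apply: half => // f cf bf.
  by rewrite PQ.
- by move=> _; rewrite -ge0_fin_numE// fin_num_measure.
Qed.

End uniqueness.

(** * Euclidean norm and moments *)

Section euclidean_norm.
Context (R : realType) (d : nat).
Implicit Types x y : 'rV[R]_d.

Let ssq x : R := \sum_(i < d) x ord0 i ^+ 2.

Let ssq_ge0 x : 0 <= ssq x.
Proof. by apply: sumr_ge0 => i _; exact: sqr_ge0. Qed.

Lemma enorm_ge0 x : 0 <= enorm x. Proof. exact: sqrtr_ge0. Qed.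

Let enorm_sqr x : enorm x ^+ 2 = ssq x. Proof. by rewrite sqr_sqrtr// ssq_ge0. Qed.

Lemma coord_le_enorm x i : `|x ord0 i| <= enorm x.
Proof.
rewrite -sqrtr_sqr ler_sqrt ?ssq_ge0// (bigD1 i)//= lerDl.
by apply: sumr_ge0 => j _; exact: sqr_ge0.
Qed.

Lemma enorm0 : enorm (0 : 'rV[R]_d) = 0.
Proof.
by rewrite /enorm big1 ?sqrtr0// => i _; rewrite mxE expr0n.
Qed.

Lemma enorm_eq0 x : enorm x = 0 -> x = 0.
Proof.
move=> x0; apply/rowP => i; rewrite mxE; apply/eqP; rewrite -normr_le0.
by rewrite -x0 coord_le_enorm.
Qed.

Lemma enormN x : enorm (- x) = enorm x.
Proof. by congr Num.sqrt; apply: eq_bigr => i _; rewrite mxE sqrrN. Qed.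

(** Cauchy-Schwarz: sum the inequalities [(enorm y * x_i - enorm x * y_i) ^ 2 >= 0] and divide. *)
Let dot_le x y : \sum_(i < d) x ord0 i * y ord0 i <= enorm x * enorm y.
Proof.
have [x0|x0] := eqVneq (enorm x) 0.
  by rewrite x0 mul0r (enorm_eq0 x0) big1// => i _; rewrite mxE mul0r.
have [y0|y0] := eqVneq (enorm y) 0.
  by rewrite y0 mulr0 (enorm_eq0 y0) big1// => i _; rewrite mxE mulr0.
have xy0 : 0 < enorm x * enorm y.
  by rewrite mulr_gt0// lt_neqAle eq_sym ?x0 ?y0 enorm_ge0.
have : \sum_(i < d) (2 * (enorm x * enorm y) * (x ord0 i * y ord0 i)) <=
    \sum_(i < d) (enorm y ^+ 2 * x ord0 i ^+ 2 + enorm x ^+ 2 * y ord0 i ^+ 2).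
  by apply: ler_sum => i _; rewrite -subr_ge0;
    have := sqr_ge0 (enorm y * x ord0 i - enorm x * y ord0 i); nra.
rewrite -mulr_sumr big_split/= -!mulr_sumr -/(ssq x) -/(ssq y) -!enorm_sqr => h.
by rewrite -(ler_pM2l xy0); nra.
Qed.

Lemma ler_enormD x y : enorm (x + y) <= enorm x + enorm y.
Proof.
rewrite -ler_sqr ?nnegrE ?addr_ge0 ?enorm_ge0// enorm_sqr.
have -> : ssq (x + y) = ssq x + 2 * (\sum_(i < d) x ord0 i * y ord0 i) + ssq y.
  rewrite /ssq mulr_sumr -!big_split/=; apply: eq_bigr => i _.
  by rewrite mxE; ring.
by have := dot_le x y; rewrite -!enorm_sqr; nra.
Qed.

Lemma enorm_continuous : continuous (@enorm R d).
Proof.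
move=> x; apply: continuous_comp; last exact: sqrt_continuous.
apply: continuous_big => [|i _ y]; first exact: add_continuous.
apply: (@continuous_comp _ _ _ (fun y : 'rV[R]_d => y ord0 i) (fun z => z ^+ 2)).
  exact: coord_continuous.
exact: exprn_continuous.
Qed.

Lemma compact_enorm_ball (r : R) : compact [set x : 'rV[R]_d | enorm x <= r].
Proof.
apply: bounded_closed_compact.
  exists r; split; first exact: num_real.
  move=> M rM x /= xr; rewrite /Num.norm/= mx_normrE; apply/bigmax_leP; split.
    by rewrite ltW// (le_lt_trans _ rM)// (le_trans _ xr)// enorm_ge0.
  move=> [i j] _ /=; rewrite (ord1 i) (le_trans (coord_le_enorm _ _))//.
  by rewrite (le_trans xr)// ltW.
rewrite (_ : [set x | _] = @enorm R d @^-1` [set y | y <= r])//.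
by apply: preimage_closed; [move=> x _; exact: enorm_continuous|exact: closed_le].
Qed.

End euclidean_norm.

(** Away from [0] the function is [expR (p * ln |a|)]. At [0], where [powR] has a separate clause,
    the neighbourhood [|b| < e ^ (1/p)] works. *)
Lemma norm_powR_continuous (R : realType) (p : R) : 0 < p ->
  continuous (fun a : R => `|a| `^ p).
Proof.
move=> p0 a; have [->|a0] := eqVneq a 0.
  rewrite /continuous_at normr0 powR0 ?gt_eqF//.
  apply/cvgrPdist_lt => e e0; near=> b.
  rewrite sub0r normrN ger0_norm ?powR_ge0//.
  rewrite -[ltRHS](_ : (e `^ p^-1) `^ p = e); last first.
    by rewrite -powRrM mulVf ?gt_eqF// powRr1// ltW.
  rewrite gt0_ltr_powR// ?nnegrE ?powR_ge0//.
  near: b; exists (e `^ p^-1) => /=; first exact: powR_gt0.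
  by move=> y; rewrite /= sub0r normrN.
have na0 : 0 < `|a| by rewrite normr_gt0.
have cl : {for a, continuous (fun b : R => ln `|b|)}.
  apply: (@continuous_comp _ _ _ (fun b : R => `|b|) (@ln R)).
    exact: norm_continuous.
  exact: continuous_ln.
have cE : {for a, continuous (fun b : R => expR (p * ln `|b|))}.
  apply: (@continuous_comp _ _ _ (fun b : R => p * ln `|b|) expR).
    exact: cvgMl_tmp cl.
  exact: continuous_expR.
rewrite /continuous_at /powR (gt_eqF na0) (gt_eqF p0); 
apply: (@cvg_trans _ (expR (p * ln `|b|) @[b --> nbhs (a : R)])); last exact: cE.
apply: near_eq_cvg; near=> b.
have nb0 : `|b| != 0.
  rewrite normr_eq0; near: b.
  exact: (@cvgr_neq0 _ _ _ (nbhs a) _ id a cvg_id a0).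
by rewrite (negbTE nb0).
Unshelve. all: by end_near. Qed.

(** If [b <= (l - 1) * a] then [a + b <= l * a]; otherwise [a + b <= l / (l - 1) * b]. The
    coefficient of [a ^ p] can be brought as near to 1 as desired at the expense of that of [b ^ p];
    this freedom later produces a sharp [2 ^ p]. *)
Lemma powR_ge0D (R : realType) (p l a b : R) : 0 < p -> 1 < l -> 0 <= a -> 0 <= b ->
  (a + b) `^ p <= l `^ p * a `^ p + (l / (l - 1)) `^ p * b `^ p.
Proof.
move=> p0 l1 a0 b0.
have l10 : 0 < l - 1 by rewrite subr_gt0.
have l0 : 0 <= l by lra.
have ll0 : 0 <= l / (l - 1) by rewrite divr_ge0// ltW.
have [ba|ab] := leP b ((l - 1) * a).
  rewrite -[leLHS]addr0; apply: lerD; last by rewrite mulr_ge0// powR_ge0.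
  rewrite -powRM//; apply: ge0_ler_powR; rewrite ?nnegrE ?addr_ge0 ?mulr_ge0//; lra.
rewrite -[leLHS]add0r; apply: lerD; first by rewrite mulr_ge0// powR_ge0.
rewrite -powRM//; apply: ge0_ler_powR; rewrite ?nnegrE ?addr_ge0 ?(mulr_ge0 ll0)//; first lra.
have -> : l / (l - 1) * b = b / (l - 1) + b by field; lra.
by rewrite lerD2r ler_pdivlMr// ltW// mulrC.
Qed.

Section borel_rV_measurability.
Context (R : realType) (n : nat).

Lemma measurable_coord i :
  measurable_fun setT (fun x : borel_rV R n => (x : 'rV[R]_n) ord0 i).
Proof. by apply: continuous_borel_fun; exact: coord_continuous. Qed.

(* ['rV[R]_n] has a countable basis of rational boxes. *)
Lemma measurable_rV d (T : measurableType d) (f : T -> 'rV[R]_n) :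
  (forall i, measurable_fun setT (fun x => f x ord0 i)) ->
  measurable_fun setT (f : T -> borel_rV R n).
Proof.
move=> mf; apply: (@measurability _ _ T (borel_rV R n) setT f (@open 'rV[R]_n)) => //.
move=> _ [ O oO <-]; rewrite setTI.
pose B (q : 'rV[rat]_n * nat) : set 'rV[R]_n :=
  [set v | forall i, `|ratr (q.1 ord0 i) - v ord0 i| < q.2.+1%:R^-1].
pose D := [set q | B q `<=` O].
have -> : f @^-1` O = \bigcup_(q in D) (f @^-1` (B q)).
  apply/seteqP; split => [x Ofx|x [q Dq Bx]]; last exact: Dq.
  have /nbhs_ballP[e /= e0 Oe] : nbhs (f x) O by exact: open_nbhs_nbhs.
  (* A point of the box and [f x] are each within one radius of the rational centre, so twice the
     radius has to fit into [e]. *)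
  pose k := Num.truncn (2 / e).
  have ke : k.+1%:R^-1 + k.+1%:R^-1 <= e :> R.
    have : 2 / e < k.+1%:R by rewrite truncnS_gt.
    rewrite ltr_pdivrMr// => h.
    rewrite -(@ler_pM2l _ k.+1%:R)// mulrDr divff//; lra.
  have k0 : 0 < k.+1%:R^-1 :> R by rewrite invr_gt0.
  have h i : {c : rat | `|ratr c - f x ord0 i| < k.+1%:R^-1}.
    apply: cid.
    have /rat_in_itvoo[c] : f x ord0 i - k.+1%:R^-1 < f x ord0 i + k.+1%:R^-1.
      by rewrite ltrBlDr -addrA ltrDl addr_gt0.
    rewrite in_itv/= => /andP[c1 c2]; exists c; rewrite ltr_norml ltrBrDl.
    by rewrite c1 ltrBlDl c2.
  exists (\row_i sval (h i), k); last first.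
    by move=> i; rewrite /= mxE; exact: (svalP (h i)).
  move=> v Bv; apply: Oe; split => // i j; rewrite (ord1 i) -ball_normE /=.
  have := Bv j; rewrite /= mxE; have := svalP (h j); set c := ratr _ => h1 h2.
  apply: lt_le_trans ke; rewrite -(subrKA c); apply: le_lt_trans (ler_normD _ _) _.
  by apply: ltrD => //; rewrite distrC.
rewrite bigcup_mkcond; apply: countable_bigcupT_measurable => // q.
case: ifPn => // _.
rewrite (_ : f @^-1` B q = \bigcap_(i in [set: 'I_n])
    ((fun x => f x ord0 i) @^-1` [set y | `|ratr (q.1 ord0 i) - y| < q.2.+1%:R^-1])).
  apply: fin_bigcap_measurable => //.
  move=> i _ /=; set Y := [set y | _].
  have := mf i measurableT Y; rewrite setTI; apply.
  rewrite /Y; clear Y.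
  rewrite (_ : [set y | _] = `]ratr (q.1 ord0 i) - q.2.+1%:R^-1, ratr (q.1 ord0 i) + q.2.+1%:R^-1[%classic)//.
  by apply/seteqP; split => y /=; rewrite in_itv/= ltr_distlC.
by apply/seteqP; split => [x Bx i _|x Bx i]; [exact: Bx|exact: (Bx i)].
Qed.

Lemma measurable_enorm : measurable_fun setT (fun x : borel_rV R n => enorm (x : 'rV[R]_n)).
Proof. by apply: continuous_borel_fun; exact: enorm_continuous. Qed.

Lemma measurable_coord_comp d (T : measurableType d) (f : T -> borel_rV R n) i :
  measurable_fun setT f -> measurable_fun setT (fun x => (f x : 'rV[R]_n) ord0 i).
Proof.
exact: (@measurableT_comp _ _ _ _ _ _
  (fun y : borel_rV R n => (y : 'rV[R]_n) ord0 i) _ f (measurable_coord i)).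
Qed.

Lemma measurable_enorm_comp d (T : measurableType d) (f : T -> borel_rV R n) :
  measurable_fun setT f -> measurable_fun setT (fun x => enorm (f x : 'rV[R]_n)).
Proof.
exact: (@measurableT_comp _ _ _ _ _ _
  (fun y : borel_rV R n => enorm (y : 'rV[R]_n)) _ f measurable_enorm).
Qed.

End borel_rV_measurability.

Lemma measurable_powR_comp (R : realType) d (T : measurableType d) (f : T -> R)
    (D : set T) (p : R) : measurable_fun D f -> measurable_fun D (fun x => f x `^ p).
Proof.
exact: (@measurableT_comp _ _ _ _ _ _ (fun y : R => y `^ p) _ f (measurable_powR p)).
Qed.

Section image_integrals.
Context (R : realType) d d' (T : measurableType d) (T' : measurableType d').
Variables (P : probability T R) (Q : probability T' R) (phi : T -> T').
Hypothesis mphi : measurable_fun setT phi.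
Hypothesis PQ : forall A, measurable A -> Q A = P (phi @^-1` A).

Let nu : {measure set T' -> \bar R} :=
  measure_function_pushforward__canonical__measure_function_Measure P mphi.

Lemma ge0_integral_image (f : T' -> \bar R) :
  measurable_fun setT f -> (forall y, 0 <= f y)%E ->
  (\int[Q]_y f y = \int[P]_x f (phi x))%E.
Proof.
move=> mf f0.
rewrite (eq_measure_integral nu); last by move=> A mA _; exact: PQ.
by rewrite ge0_integral_pushforward.
Qed.

Lemma Rintegral_image (f : T' -> R) (B : R) :
  measurable_fun setT f -> (forall y, `|f y| <= B) ->
  \int[Q]_y f y = \int[P]_x f (phi x).
Proof.
move=> mf fB; congr fine.
rewrite (eq_measure_integral nu); last by move=> A mA _; exact: PQ.
rewrite integral_pushforward//; first exact/measurable_EFinP.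
rewrite preimage_setT; apply: (bounded_integrable P (f := f \o phi) (B := B)) => //.
  exact: measurableT_comp.
by move=> x; exact: fB.
Qed.

End image_integrals.

Lemma Rintegral_bounded_EFin (R : realType) d (T : measurableType d)
    (P : probability T R) (f : T -> R) (B : R) :
  measurable_fun setT f -> (forall x, `|f x| <= B) ->
  (\int[P]_x (f x)%:E = (\int[P]_x f x)%:E)%E.
Proof.
move=> mf fB; rewrite fineK//; apply: integrable_fin_num => //.
exact: bounded_integrable fB.
Qed.

(** * Compactness from moment bounds *)

Section moment_limits.
Context (R : realType) (n : nat) (p : R).
Hypothesis p0 : 0 < p.
Local Notation X := (borel_rV R n).
Context (I : Type) (U : set_system I) (UU : UltraFilter U).

Lemma enorm_powR_continuous : continuous (fun x : 'rV[R]_n => enorm x `^ p).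
Proof.
move=> x; under eq_fun => y do rewrite -(ger0_norm (enorm_ge0 y)).
apply: (@continuous_comp _ _ _ (@enorm R n) (fun a => `|a| `^ p)).
  exact: enorm_continuous.
exact: norm_powR_continuous.
Qed.

(** The truncations of [g] at [k] are bounded and continuous, so their integrals pass to the limit;
    monotone convergence in [k] recovers [g]. *)
Lemma le_limit_integral (P : I -> probability X R) (Q : probability X R)
    (g : 'rV[R]_n -> R) (c : I -> R) (c0 : R) :
  (forall (f : 'rV[R]_n -> R) B, continuous f -> (forall x, `|f x| <= B) ->
    (fun i => \int[P i]_x f x) @ U --> \int[Q]_x f x) ->
  continuous g -> (forall x, 0 <= g x) ->
  (forall i, (\int[P i]_x (g x)%:E <= (c i)%:E)%E) -> c @ U --> c0 ->
  (\int[Q]_x (g x)%:E <= c0%:E)%E.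
Proof.
move=> PQ cg g0 gc cc0.
have mg := continuous_borel_fun cg.
pose gk k x : R := Num.min (g x) k%:R.
have cgk k : continuous (gk k).
  by move=> x; apply: (@continuous_min _ _ g (cst k%:R) x); [exact: cg|exact: cst_continuous].
have gk0 k x : 0 <= gk k x by rewrite le_min g0 ler0n.
have gkB k x : `|gk k x| <= k%:R by rewrite ger0_norm// ge_min lexx orbT.
have mgk k := continuous_borel_fun (cgk k).
have gkc k : (\int[Q]_x (gk k x)%:E <= c0%:E)%E.
  rewrite (Rintegral_bounded_EFin _ (mgk k) (gkB k)) lee_fin.
  apply: (le_filter_lim (PQ _ _ (cgk k) (gkB k)) cc0) => i.
  rewrite -lee_fin -(Rintegral_bounded_EFin _ (mgk k) (gkB k)).
  apply: le_trans (gc i); apply: ge0_le_integral => //.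
  - by move=> x _; rewrite lee_fin.
  - exact/measurable_EFinP.
  - exact/measurable_EFinP.
  - by move=> x _; rewrite lee_fin ge_min lexx.
have gklim (x : X) : (gk k x)%:E @[k --> \oo] --> (g x)%:E.
  apply: cvg_near_cst; near=> k; congr EFin; apply/min_idPl.
  by near: k; exact: nbhs_infty_ger.
have cv : (fun k => \int[Q]_x (gk k x)%:E)%E @ \oo -->
    (\int[Q]_x (limn (fun k => (gk k x)%:E)))%E.
  apply: cvg_monotone_convergence => //.
  - by move=> k; exact/measurable_EFinP.
  - by move=> k x _; rewrite lee_fin.
  - move=> x _ k l kl; rewrite lee_fin le_min ge_min lexx/= ge_min ler_nat kl.
    by rewrite orbT.
have -> : (\int[Q]_x (g x)%:E = \int[Q]_x (limn (fun k => (gk k x)%:E)))%E.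
  by apply: eq_integral => x _; apply/esym/cvg_lim => //; exact: gklim.
rewrite -(cvg_lim _ cv)//; apply: lime_le; first by apply/cvg_ex; eexists; exact: cv.
by apply: nearW => k; exact: gkc.
Unshelve. all: by end_near. Qed.

Lemma moment_compactness (P : I -> probability X R) (M : R) :
  (forall i, (\int[P i]_x (enorm (x : 'rV[R]_n) `^ p)%:E <= M%:E)%E) ->
  exists2 Q : probability X R,
    forall (f : 'rV[R]_n -> R) B, continuous f -> (forall x, `|f x| <= B) ->
      (fun i => \int[P i]_x f x) @ U --> \int[Q]_x f x &
    (\int[Q]_x (enorm (x : 'rV[R]_n) `^ p)%:E <= M%:E)%E.
Proof.
move=> PM.
have [|||Q QO] := @tight_ultra_open R 'rV[R]_n _ _ I U UU P _.
- exact: norm_hausdorff.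
- exact: uniform_regular.
- move=> e e0.
  have [i _] := filter_ex (@filterT _ U _).
  have M0 : 0 <= M.
    by rewrite -lee_fin; apply: le_trans (PM i); apply: integral_ge0 => x _; rewrite lee_fin powR_ge0.
  (* Markov's inequality bounds the mass outside this ball by [M / r ^ p <= e]; the [+ 1] keeps [r]
     positive when [M = 0]. *)
  pose r := ((M + 1) / e) `^ p^-1.
  have r0 : 0 < r by rewrite powR_gt0// divr_gt0// ltr_wpDl.
  have rp : r `^ p = (M + 1) / e.
    by rewrite -powRrM mulVf ?gt_eqF// powRr1// ltW// divr_gt0// ltr_wpDl.
  exists [set x : 'rV[R]_n | enorm x <= r]; first exact: compact_enorm_ball.
  move=> j; set K := [set x | _].
  have mK : measurable (K : set X).
    by apply: closed_borel; apply: compact_closed; [exact: norm_hausdorff|exact: compact_enorm_ball].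
  have mKC : measurable (~` K : set X) by exact: measurableC.
  suff h : fine (P j (~` K)) <= e.
    rewrite -[K]setCK probability_setC// -(fineK (fin_num_measure (P j) _ mKC)).
    by rewrite -EFinB lee_fin lerD2l lerN2.
  have rp0 : 0 < r `^ p by rewrite powR_gt0.
  rewrite -(ler_pM2l rp0) (_ : r `^ p * e = M + 1); last by rewrite rp divfK ?gt_eqF.
  apply: (@le_trans _ _ M); last by rewrite lerDl.
  rewrite -lee_fin; apply: le_trans (PM j).
  rewrite EFinM fineK ?fin_num_measure//.
  have h0 (x : X) : setT x -> (0 <= (\1_(~` K) x : R)%:E)%E.
    by move=> _; rewrite lee_fin indicE ler0n.
  have h1 : measurable_fun setT (fun x : X => (\1_(~` K) x : R)%:E).
    by apply/measurable_EFinP; exact: measurable_indic.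
  rewrite -[X in (_ * P j X <= _)%E]setIT -integral_indic//.
  rewrite -ge0_integralZl_EFin ?powR_ge0//.
  apply: ge0_le_integral => //.
  - by move=> x _; rewrite -EFinM lee_fin mulr_ge0 ?powR_ge0// indicE ler0n.
  - exact: measurable_funeM.
  - by apply/measurable_EFinP; apply: continuous_borel_fun; exact: enorm_powR_continuous.
  - move=> x _; rewrite -EFinM lee_fin indicE.
    case: (boolP (x \in ~` K)) => [/set_mem/negP|_]; last by rewrite mulr0 powR_ge0.
    rewrite -ltNge mulr1 => xr; apply: ge0_ler_powR; rewrite ?nnegrE ?enorm_ge0//; exact: ltW.
have cvgQ := portmanteau_ultra UU QO.
exists Q => //.
apply: (le_limit_integral cvgQ (c := cst M)) => //.
- exact: enorm_powR_continuous.
- by move=> x; exact: powR_ge0.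
- exact: cvg_cst.
Qed.

End moment_limits.

(** * Couplings and the Wasserstein distance *)

Section couplings.
Context (R : realType) (d : nat) (p : R).
Hypothesis p0 : 0 < p.
Local Notation X := (borel_rV R d).
Local Notation rV := 'rV[R]_d.
Implicit Types mu nu : Pp d p.

Definition moment mu : R := \int[mu]_x (enorm (x : rV) `^ p).

Lemma measurable_enorm_powR : measurable_fun setT (fun x : X => enorm (x : rV) `^ p).
Proof. by apply: continuous_borel_fun; exact: enorm_powR_continuous. Qed.

Lemma moment_ge0 mu : 0 <= moment mu.
Proof. by apply: Rintegral_ge0 => x _; exact: powR_ge0. Qed.

Lemma momentE mu : (\int[mu]_x (enorm (x : rV) `^ p)%:E = (moment mu)%:E)%E.
Proof.
rewrite fineK// ge0_fin_numE ?finite_moment//.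
by apply: integral_ge0 => x _; rewrite lee_fin powR_ge0.
Qed.

Lemma measurable_dist :
  measurable_fun setT (fun xy : X * X => enorm ((xy.1 : rV) - xy.2)).
Proof.
apply: (measurable_enorm_comp (f := fun xy : X * X => ((xy.1 : rV) - xy.2 : rV) : X)).
apply: measurable_rV => i.
rewrite (_ : (fun x : X * X => _) =
    (fun x : X * X => (x.1 : rV) ord0 i - (x.2 : rV) ord0 i)); last first.
  by apply/funext => x; rewrite !mxE.
by apply: measurable_funB; apply: measurable_coord_comp;
  [exact: measurable_fst|exact: measurable_snd].
Qed.

Lemma measurable_row : measurable_fun setT
  (fun xy : X * X => row_mx (xy.1 : rV) (xy.2 : rV) : borel_rV R (d + d)).
Proof.
apply: measurable_rV => i; rewrite -(splitK i); case: (fintype.split i) => j /=.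
  under eq_fun do rewrite row_mxEl.
  by apply: measurable_coord_comp; exact: measurable_fst.
under eq_fun do rewrite row_mxEr.
by apply: measurable_coord_comp; exact: measurable_snd.
Qed.

Lemma transport_cost_ge0 (gamma : probability (X * X)%type R) : (0 <= transport_cost p gamma :> \bar R)%E.
Proof. by apply: integral_ge0 => x _; rewrite lee_fin powR_ge0. Qed.

Section coupling_integrals.
Variables (mu nu : Pp d p) (gamma : probability (X * X)%type R).
Hypothesis cgamma : coupling mu nu gamma.

Lemma ge0_integral_coupling1 (f : X -> \bar R) : measurable_fun setT f ->
  (forall x, 0 <= f x)%E -> (\int[gamma]_xy f xy.1 = \int[mu]_x f x)%E.
Proof.
move=> mf f0; apply/esym.
apply: (ge0_integral_image (P := gamma) (phi := fst)) => //.
move=> A mA; rewrite -(proj1 cgamma)//; congr (gamma _).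
by apply/seteqP; split => -[x y] //= [].
Qed.

Lemma ge0_integral_coupling2 (f : X -> \bar R) : measurable_fun setT f ->
  (forall x, 0 <= f x)%E -> (\int[gamma]_xy f xy.2 = \int[nu]_x f x)%E.
Proof.
move=> mf f0; apply/esym.
apply: (ge0_integral_image (P := gamma) (phi := snd)) => //.
move=> A mA; rewrite -(proj2 cgamma)//; congr (gamma _).
by apply/seteqP; split => -[x y] //= [].
Qed.

Lemma Rintegral_coupling1 (f : X -> R) B : measurable_fun setT f ->
  (forall x, `|f x| <= B) -> \int[gamma]_xy f xy.1 = \int[mu]_x f x.
Proof.
move=> mf fB; apply/esym.
apply: (Rintegral_image (P := gamma) (phi := fst) _ _ mf fB) => //.
move=> A mA; rewrite -(proj1 cgamma)//; congr (gamma _).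
by apply/seteqP; split => -[x y] //= [].
Qed.

Lemma Rintegral_coupling2 (f : X -> R) B : measurable_fun setT f ->
  (forall x, `|f x| <= B) -> \int[gamma]_xy f xy.2 = \int[nu]_x f x.
Proof.
move=> mf fB; apply/esym.
apply: (Rintegral_image (P := gamma) (phi := snd) _ _ mf fB) => //.
move=> A mA; rewrite -(proj2 cgamma)//; congr (gamma _).
by apply/seteqP; split => -[x y] //= [].
Qed.

(* Integrates [h xy <= l^p f xy + (l/(l-1))^p g xy]. *)
Let integral_powR_split (h f g : X * X -> R) (l : R) : 1 < l ->
  (forall z, 0 <= h z) -> (forall z, 0 <= f z) -> (forall z, 0 <= g z) ->
  measurable_fun setT h -> measurable_fun setT f -> measurable_fun setT g ->
  (forall z, h z <= f z + g z) ->
  (\int[gamma]_z (h z `^ p)%:E <=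
    (l `^ p)%:E * \int[gamma]_z (f z `^ p)%:E +
    ((l / (l - 1)) `^ p)%:E * \int[gamma]_z (g z `^ p)%:E)%E.
Proof.
move=> l1 h0 f0 g0 mh mf mg hfg.
have mE k : measurable_fun setT k -> measurable_fun setT (fun z : X * X => (k z `^ p)%:E).
  by move=> mk; apply/measurable_EFinP; exact: measurable_powR_comp.
have pos k (z : X * X) : (0 <= (k z `^ p)%:E :> \bar R)%E by rewrite lee_fin powR_ge0.
rewrite -!ge0_integralZl_EFin ?powR_ge0//; try exact: mE.
rewrite -ge0_integralD//; last 4 first.
- by move=> z _; rewrite -EFinM lee_fin mulr_ge0 ?powR_ge0.
- by apply: measurable_funeM; exact: mE.
- by move=> z _; rewrite -EFinM lee_fin mulr_ge0 ?powR_ge0.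
- by apply: measurable_funeM; exact: mE.
apply: ge0_le_integral => //; first exact: mE.
  by apply: emeasurable_funD; apply: measurable_funeM; exact: mE.
move=> z _; rewrite -!EFinM -EFinD lee_fin.
apply: le_trans (powR_ge0D p0 l1 (f0 z) (g0 z)).
by apply: ge0_ler_powR; rewrite ?nnegrE ?addr_ge0//; exact: ltW.
Qed.

Let mnorm1 : measurable_fun setT (fun xy : X * X => enorm (xy.1 : rV)).
Proof. by apply: measurable_enorm_comp; exact: measurable_fst. Qed.

Let mnorm2 : measurable_fun setT (fun xy : X * X => enorm (xy.2 : rV)).
Proof. by apply: measurable_enorm_comp; exact: measurable_snd. Qed.

Let int1 : (\int[gamma]_xy (enorm (xy.1 : rV) `^ p)%:E = (moment mu)%:E)%E.
Proof.
rewrite -momentE -(ge0_integral_coupling1 (f := fun x => (enorm (x : rV) `^ p)%:E))//.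
  by apply/measurable_EFinP; exact: measurable_enorm_powR.
by move=> x; rewrite lee_fin powR_ge0.
Qed.

Let int2 : (\int[gamma]_xy (enorm (xy.2 : rV) `^ p)%:E = (moment nu)%:E)%E.
Proof.
rewrite -momentE -(ge0_integral_coupling2 (f := fun x => (enorm (x : rV) `^ p)%:E))//.
  by apply/measurable_EFinP; exact: measurable_enorm_powR.
by move=> x; rewrite lee_fin powR_ge0.
Qed.

Lemma transport_cost_le (l : R) : 1 < l ->
  (transport_cost p gamma <=
    (l `^ p * moment mu + (l / (l - 1)) `^ p * moment nu)%:E)%E.
Proof.
move=> l1; rewrite EFinD !EFinM -int1 -int2.
apply: integral_powR_split => //; try (by move=> z; exact: enorm_ge0);
  try exact: measurable_dist.
move=> z.
by rewrite -(enormN (z.2 : rV)) ler_enormD.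
Qed.

Lemma moment_le_cost (l : R) : 1 < l ->
  ((moment mu)%:E <= (l `^ p)%:E * transport_cost p gamma +
    ((l / (l - 1)) `^ p * moment nu)%:E)%E.
Proof.
move=> l1; rewrite EFinM -int1 -int2.
apply: integral_powR_split => //; try (by move=> z; exact: enorm_ge0);
  try exact: measurable_dist.
move=> z.
by rewrite -[in X in enorm X <= _](subrK (z.2 : rV) (z.1 : rV)) ler_enormD.
Qed.

Lemma transport_cost_fin : (transport_cost p gamma < +oo)%E.
Proof. by apply: le_lt_trans (@transport_cost_le 2 _) (ltry _); lra. Qed.

Lemma enorm_row_integral_le (M : R) : moment mu <= M -> moment nu <= M ->
  (\int[gamma]_xy (enorm (row_mx (xy.1 : rV) (xy.2 : rV)) `^ p)%:E <=
    (2 * (2 `^ p * M))%:E)%E.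
Proof.
move=> muM nuM.
have enorm_row (x y : rV) : enorm (row_mx x y) <= enorm x + enorm y.
  have -> : row_mx x y = row_mx x 0 + row_mx 0 y by rewrite add_row_mx addr0 add0r.
  apply: le_trans (ler_enormD _ _) _; apply: lerD; rewrite /enorm big_split_ord/=.
    rewrite [X in _ + X]big1 ?addr0 => [|i _]; last by rewrite row_mxEr mxE expr0n.
    by under eq_bigr do rewrite row_mxEl.
  rewrite [X in X + _]big1 ?add0r => [|i _]; last by rewrite row_mxEl mxE expr0n.
  by under eq_bigr do rewrite row_mxEr.
(* At [l = 2] the factors [l] and [l / (l - 1)] coincide, which treats both marginals alike. *)
apply: (@le_trans _ _ ((2 `^ p)%:E * (moment mu)%:E + ((2 / (2 - 1)) `^ p)%:E * (moment nu)%:E)%E).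
  rewrite -int1 -int2; apply: integral_powR_split => //;
    try (by move=> z; exact: enorm_ge0).
  - lra.
  - by apply: (measurable_enorm_comp (f := fun z : X * X => row_mx (z.1 : rV) (z.2 : rV)));
      exact: measurable_row.
have -> : 2 / (2 - 1) = 2 :> R by field; lra.
have p2 : 0 <= 2 `^ p :> R by exact: powR_ge0.
by rewrite -!EFinM -EFinD lee_fin; nra.
Qed.

End coupling_integrals.

Lemma product_coupling mu nu : exists gamma, coupling mu nu gamma.
Proof.
pose m : {measure set (X * X) -> \bar R} :=
  ((mu : probability X R) \x (nu : probability X R))%E.
have mE A B : measurable A -> measurable B -> m (A `*` B) = (mu A * nu B)%E.
  exact: product_measure1E.
have m1 : m setT = 1%E by rewrite -setXTT mE// !probability_setT mule1.
have [gamma gE] := measure_probability m1.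
exists gamma; split => A mA; rewrite gE mE// probability_setT.
  by rewrite mule1.
by rewrite mul1e.
Qed.

Lemma Wp_ge0 mu nu : 0 <= Wp mu nu.
Proof. exact: powR_ge0. Qed.

Let inf_ge0 mu nu :
  (0 <= ereal_inf [set transport_cost p gamma | gamma in coupling mu nu])%E.
Proof. by apply: le_ereal_inf_tmp => _ [g _ <-]; exact: transport_cost_ge0. Qed.

Let inf_fin mu nu :
  ereal_inf [set transport_cost p gamma | gamma in coupling mu nu] \is a fin_num.
Proof.
rewrite ge0_fin_numE//; have [g cg] := product_coupling mu nu.
by apply: le_lt_trans (transport_cost_fin cg); apply: ereal_inf_lbound; exists g.
Qed.

Lemma Wp_powE mu nu : (Wp mu nu `^ p)%:E =
  ereal_inf [set transport_cost p gamma | gamma in coupling mu nu].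
Proof.
by rewrite -powRrM mulVf ?gt_eqF// powRr1 ?fineK// fine_ge0.
Qed.

Lemma Wp_pow_le mu nu gamma c : coupling mu nu gamma ->
  (transport_cost p gamma <= c%:E)%E -> Wp mu nu `^ p <= c.
Proof.
move=> cg gc; rewrite -lee_fin Wp_powE; apply: le_trans gc.
by apply: ereal_inf_lbound; exists gamma.
Qed.

Lemma near_optimal_coupling mu nu c : Wp mu nu `^ p < c ->
  exists2 gamma, coupling mu nu gamma & (transport_cost p gamma <= c%:E)%E.
Proof.
rewrite -lte_fin Wp_powE => /ereal_inf_lt[_ [g cg <-]] gc.
by exists g => //; exact: ltW.
Qed.

(** The moment is the [p]-th power of the distance to the Dirac mass at 0. This lemma and the next
    one are triangle inequalities, with constants, in which that mass is one of the three points. *)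
Lemma Wp_pow_le_moment mu nu l : 1 < l ->
  Wp mu nu `^ p <= l `^ p * moment mu + (l / (l - 1)) `^ p * moment nu.
Proof.
move=> l1; have [g cg] := product_coupling mu nu.
exact: Wp_pow_le cg (transport_cost_le cg l1).
Qed.

Lemma moment_le_Wp mu nu l : 1 < l ->
  moment mu <= l `^ p * Wp mu nu `^ p + (l / (l - 1)) `^ p * moment nu.
Proof.
move=> l1; apply/ler_addgt0Pr => e e0.
have lp : 0 < l `^ p by rewrite powR_gt0//; lra.
have [|g cg gW] := @near_optimal_coupling mu nu (Wp mu nu `^ p + e / l `^ p).
  by rewrite ltrDl divr_gt0.
rewrite -lee_fin; apply: le_trans (moment_le_cost cg l1) _.
apply: (@le_trans _ _ ((l `^ p)%:E * (Wp mu nu `^ p + e / l `^ p)%:E +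
    ((l / (l - 1)) `^ p * moment nu)%:E)%E).
  by apply: leeD => //; apply: lee_wpmul2l => //; rewrite lee_fin ltW.
rewrite -EFinM -EFinD lee_fin mulrDr mulrCA divff ?gt_eqF//; lra.
Qed.

Lemma Wp_pow_le0 mu nu : Wp mu nu `^ p <= 0 -> Wp mu nu = 0.
Proof.
move=> h; apply: (@powR_eq0_eq0 _ _ p); apply/eqP.
by rewrite eq_le h powR_ge0.
Qed.

Lemma transport_cost_image d' (T : measurableType d') (P : probability T R)
    (phi : T -> X * X) (gamma : probability (X * X)%type R) :
  measurable_fun setT phi -> (forall A, gamma A = P (phi @^-1` A)) ->
  transport_cost p gamma =
    (\int[P]_x (enorm (((phi x).1 : rV) - (phi x).2) `^ p)%:E)%E.
Proof.
move=> mphi gE; rewrite /transport_cost.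
rewrite (@ge0_integral_image _ _ _ _ _ P gamma phi mphi (fun A _ => gE A)
  (fun xy => (enorm ((xy.1 : rV) - xy.2) `^ p)%:E))//.
- by apply/measurable_EFinP; apply: measurable_powR_comp; exact: measurable_dist.
- by move=> y; rewrite lee_fin powR_ge0.
Qed.

Lemma Wp_refl mu : Wp mu mu = 0.
Proof.
have md : measurable_fun setT (fun x : X => (x, x) : (X * X)%type).
  by apply: measurable_fun_pair; exact: measurable_id.
have [|g gE] := probability_image (P := mu : {measure set X -> \bar R}) md.
  exact: probability_setT.
have cg : coupling mu mu g.
  split=> A mA; rewrite gE; congr (law mu _); apply/seteqP; split => x //=; by [case|split].
apply: Wp_pow_le0; apply: (Wp_pow_le cg).
rewrite (transport_cost_image md gE) integral0_eq// => x _ /=.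
by rewrite subrr enorm0 powR0// gt_eqF.
Qed.

Lemma Wp_sym mu nu : Wp mu nu = Wp nu mu.
Proof.
suff H mu1 mu2 : Wp mu1 mu2 `^ p <= Wp mu2 mu1 `^ p.
  move: (H mu nu) (H nu mu) (Wp_ge0 mu nu) (Wp_ge0 nu mu).
  move: (Wp mu nu) (Wp nu mu) => x y xy yx x0 y0.
  by apply: (powR_injective p0); rewrite ?nnegrE//; apply/eqP; rewrite eq_le xy yx.
apply/ler_addgt0Pr => e e0.
have [|g [g1 g2] gW] := @near_optimal_coupling mu2 mu1 (Wp mu2 mu1 `^ p + e).
  by rewrite ltrDl.
have ms : measurable_fun setT (fun z : X * X => (z.2, z.1) : (X * X)%type).
  by apply: measurable_fun_pair; [exact: measurable_snd|exact: measurable_fst].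
have [|g' gE] := probability_image (P := g : {measure set _ -> \bar R}) ms.
  exact: probability_setT.
have cg' : coupling mu1 mu2 g'.
  by split=> A mA; rewrite gE; [rewrite -g2//|rewrite -g1//]; congr (g _);
    apply/seteqP; split => -[x y] /= [].
apply: (Wp_pow_le cg'); rewrite (transport_cost_image ms gE).
under eq_integral => z _ do rewrite /= -opprB enormN.
exact: gW.
Qed.

End couplings.

(** * Narrow limits and lower semicontinuity of the Wasserstein distance *)

Lemma cvg_initial_topology (S : choiceType) (T : topologicalType) (f : S -> T)
    (F : set_system S) (s : S) : Filter F ->
  f @ F --> f s -> F --> (s : initial_topology f).
Proof.
move=> FF fFs A; rewrite nbhsE => -[B [[C oC CB] Bs] BA].
apply: filterS BA _; rewrite -CB; apply: fFs.
by apply: open_nbhs_nbhs; split => //; rewrite -CB in Bs.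
Qed.

Lemma nat_ultrafilter : exists2 U : set_system nat, UltraFilter U & \oo `<=` U.
Proof. by have [U [? ?]] := ultraFilterLemma (@eventually_filter); exists U. Qed.

Section narrow_limits.
Context (R : realType) (d : nat) (p : R).
Hypothesis p0 : 0 < p.
Local Notation X := (borel_rV R d).
Local Notation rV := 'rV[R]_d.

Definition narrow_limit (I : Type) (U : set_system I) (x : I -> Pp d p)
    (a : Pp d p) : Prop :=
  forall (f : rV -> R) (B : R), continuous f -> (forall z, `|f z| <= B) ->
    (fun i => \int[x i]_z f z) @ U --> \int[a]_z f z.

Lemma bounded_fun_le (f : rV -> R) : bounded_fun f -> exists B, forall z, `|f z| <= B.
Proof.
by move=> [M [_ Mf]]; exists (M + 1) => z; apply: Mf => //; rewrite ltrDl.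
Qed.

Lemma narrow_limit_continuous (I : Type) (U : set_system I) (UU : UltraFilter U)
    (x : I -> Pp d p) (a : Pp d p) (F : Pp d p -> R) :
  narrow_continuous F -> narrow_limit U x a -> (F \o x) @ U --> F a.
Proof.
move=> cF xa.
apply: (@cvg_comp _ _ _ x F U (nbhs (a : narrow d p))); last exact: cF.
apply: (@cvg_initial_topology _ _ (@integrals R d p) (x @ U) a).
apply/cvg_sup => f; apply: cvg_initial_topology.
have [B fB] := bounded_fun_le (proj2 (svalP f)).
exact: xa (proj1 (svalP f)) fB.
Qed.

Section ultrafilter.
Context (I : Type) (U : set_system I) (UU : UltraFilter U).

Lemma narrow_compact (x : I -> Pp d p) (M : R) :
  (forall i, moment (x i) <= M) ->
  exists2 a, narrow_limit U x a & moment a <= M.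
Proof.
move=> xM; have [|Q QU QM] := @moment_compactness R d p p0 I U UU (fun i => law (x i)) M.
  by move=> i; rewrite momentE lee_fin.
have Qfin : (\int[Q]_z (enorm (z : rV) `^ p)%:E < +oo)%E by apply: le_lt_trans QM (ltry _).
by exists (MkPp Qfin) => //; rewrite -lee_fin -momentE.
Qed.

Let submx_continuous (g : 'rV[R]_(d + d) -> rV) (s : 'I_d -> 'I_(d + d)) :
  (forall v i, g v ord0 i = v ord0 (s i)) -> continuous g.
Proof.
move=> gE v A /nbhs_ballP[e /= e0 eA].
have := @nbhsx_ballx R 'rV[R]_(d + d) v e e0.
apply: (@filterS _ (nbhs v) (nbhs_filter v)) => w [_ vw]; apply: eA.
by split=> // i j; rewrite (ord1 i) !gE; exact: vw.
Qed.

Let lcont : continuous (@lsubmx R 1 d d).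
Proof. by apply: (submx_continuous (s := lshift d)) => v i; rewrite mxE. Qed.

Let rcont : continuous (@rsubmx R 1 d d).
Proof. by apply: (submx_continuous (s := @rshift d d)) => v i; rewrite mxE. Qed.

Let borel_measurable m n (g : 'rV[R]_m -> 'rV[R]_n) : continuous g ->
  measurable_fun setT (g : borel_rV R m -> borel_rV R n).
Proof.
move=> cg; apply: measurable_rV => i; apply: continuous_borel_fun => v.
apply: (@continuous_comp _ _ _ g (fun w => w ord0 i)); first exact: cg.
exact: coord_continuous.
Qed.

(* The couplings are tight as measures on ['rV_(d + d)]; their limit couples
   the limits. *)
Lemma limit_coupling (x y : I -> Pp d p) (a b : Pp d p) (M : R) (c : I -> R) (c0 : R) :
  narrow_limit U x a -> narrow_limit U y b ->
  (forall i, moment (x i) <= M) -> (forall i, moment (y i) <= M) ->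
  (forall i, Wp (x i) (y i) `^ p < c i) -> c @ U --> c0 ->
  exists2 gamma, coupling a b gamma & (transport_cost p gamma <= c0%:E)%E.
Proof.
move=> xa yb xM yM Wc cc0.
have h i : {g | coupling (x i) (y i) g /\ (transport_cost p g <= (c i)%:E)%E}.
  by apply: cid; have [g] := near_optimal_coupling p0 (Wc i); exists g.
pose g i := sval (h i).
have gc i : coupling (x i) (y i) (g i) by case: (svalP (h i)).
have gcost i : (transport_cost p (g i) <= (c i)%:E)%E by case: (svalP (h i)).
have hP i : {P : probability (borel_rV R (d + d)) R | forall A,
    P A = g i ((fun z : X * X => row_mx (z.1 : rV) (z.2 : rV)) @^-1` A)}.
  apply: cid; apply: (probability_image (P := g i : {measure set _ -> \bar R})).
    exact: measurable_row.
  exact: probability_setT.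
pose P i := sval (hP i).
have PE i A := svalP (hP i) A.
have Pge0 i f := @ge0_integral_image _ _ _ _ _ (g i) (P i) _
  (@measurable_row R d) (fun A _ => PE i A) f.
have Pint i f B := @Rintegral_image _ _ _ _ _ (g i) (P i) _
  (@measurable_row R d) (fun A _ => PE i A) f B.
have [|Q QU _] := @moment_compactness R (d + d) p p0 I U UU P (2 * (2 `^ p * M)).
  move=> i; rewrite Pge0.
  - by refine (enorm_row_integral_le p0 (gc i) (xM i) (yM i)).
  - by apply/measurable_EFinP; exact: measurable_enorm_powR.
  - by move=> z; rewrite lee_fin powR_ge0.
have mlr : measurable_fun setT
    (fun v : borel_rV R (d + d) => (lsubmx v : X, rsubmx v : X) : (X * X)%type).
  by apply: measurable_fun_pair; exact: borel_measurable.
have [|G GE] := probability_image (P := Q : {measure set _ -> \bar R}) mlr.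
  exact: probability_setT.
(* The image of [Q] under a block projection and the limit [e] integrate each bounded continuous
   function to the same ultralimit, so they agree on Borel sets. *)
have marginal (s : 'rV[R]_(d + d) -> rV) (z : I -> Pp d p) (e : Pp d p) :
    continuous s -> narrow_limit U z e ->
    (forall i (f : rV -> R) B, continuous f -> (forall v, `|f v| <= B) ->
      \int[P i]_v f (s v) = \int[z i]_v f v) ->
    forall A : set X, measurable A -> Q (s @^-1` A) = e A.
  move=> cs ze sE A mA.
  have [|S SE] := probability_image (P := Q : {measure set _ -> \bar R}) (borel_measurable cs).
    exact: probability_setT.
  rewrite -SE; apply: bounded_continuous_eq mA => f cf /bounded_fun_le[B fB].
  have mf := continuous_borel_fun cf.
  rewrite (Rintegral_image (P := Q) (borel_measurable cs) (fun A _ => SE A) mf fB).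
  have cfs : continuous (f \o s) by move=> v; apply: continuous_comp; [exact: cs|exact: cf].
  have := QU (f \o s) B cfs (fun v => fB (s v)).
  rewrite (_ : (fun i => _) = (fun i => \int[z i]_v f v)); last first.
    by apply/funext => i; exact: sE cf fB.
  by move=> /cvg_unique; apply => //; exact: ze cf fB.
exists G.
  split=> A mA; rewrite GE.
    rewrite -(marginal lsubmx x a lcont xa _ A mA).
      by congr (Q _); apply/seteqP; split => v //= [].
    move=> i f B cf fB; have mf := continuous_borel_fun cf.
    rewrite -(Rintegral_coupling1 (gc i) mf fB).
    rewrite (Pint i (fun v => f (lsubmx v)) B _ _).
    - by apply: eq_Rintegral => z _; rewrite row_mxKl.
    - by apply: continuous_borel_fun => v; apply: continuous_comp; [exact: lcont|exact: cf].
    - by move=> v; exact: fB.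
  rewrite -(marginal rsubmx y b rcont yb _ A mA).
    by congr (Q _); apply/seteqP; split => v //= [].
  move=> i f B cf fB; have mf := continuous_borel_fun cf.
  rewrite -(Rintegral_coupling2 (gc i) mf fB).
  rewrite (Pint i (fun v => f (rsubmx v)) B _ _).
  - by apply: eq_Rintegral => z _; rewrite row_mxKr.
  - by apply: continuous_borel_fun => v; apply: continuous_comp; [exact: rcont|exact: cf].
  - by move=> v; exact: fB.
have cc : continuous (fun v : 'rV[R]_(d + d) => enorm (lsubmx v - rsubmx v) `^ p).
  move=> v; under eq_fun => w do rewrite -(ger0_norm (enorm_ge0 _)).
  apply: (@continuous_comp _ _ _ (fun v : 'rV[R]_(d + d) => enorm (lsubmx v - rsubmx v))
    (fun a => `|a| `^ p)); last exact: norm_powR_continuous.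
  apply: (@continuous_comp _ _ _ (fun v : 'rV[R]_(d + d) =>
    \sum_(i < d) (lsubmx v - rsubmx v) ord0 i ^+ 2) (@Num.sqrt R)).
    2: exact: sqrt_continuous.
  apply: continuous_big => [|i _ w]; first exact: add_continuous.
  under eq_fun do rewrite !mxE.
  apply: (@continuous_comp _ _ _
    (fun w : 'rV[R]_(d + d) => w ord0 (lshift d i) - w ord0 (rshift d i)) (fun z => z ^+ 2)).
    apply: (@continuousB _ _ _ (fun w : 'rV[R]_(d + d) => w ord0 (lshift d i))
      (fun w => w ord0 (rshift d i))); exact: coord_continuous.
  exact: exprn_continuous.
have mc := continuous_borel_fun cc.
rewrite (transport_cost_image p mlr GE).
apply: (le_limit_integral UU QU cc _ _ cc0) => [v|i]; first exact: powR_ge0.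
rewrite Pge0.
- apply: le_trans (gcost i); rewrite le_eqVlt; apply/orP; left; apply/eqP.
  by apply: eq_integral => z _; rewrite row_mxKl row_mxKr.
- exact/measurable_EFinP.
- by move=> v; rewrite lee_fin powR_ge0.
Qed.

(** [limit_coupling] starts from couplings of cost strictly above the infimum; the slack [e]
    provides them and is removed at the end. *)
Lemma Wp_narrow_lsc (x y : I -> Pp d p) (a b : Pp d p) (M : R) (c : I -> R) (c0 : R) :
  narrow_limit U x a -> narrow_limit U y b ->
  (forall i, moment (x i) <= M) -> (forall i, moment (y i) <= M) ->
  (forall i, Wp (x i) (y i) `^ p <= c i) -> c @ U --> c0 ->
  Wp a b `^ p <= c0.
Proof.
move=> xa yb xM yM Wc cc0; apply/ler_addgt0Pr => e e0.
have Wce i : Wp (x i) (y i) `^ p < c i + e by rewrite (le_lt_trans (Wc i))// ltrDl.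
have cce : (fun i => c i + e) @ U --> c0 + e.
  by apply: (@cvgD _ _ _ _ _ c (cst e)) => //; exact: cvg_cst.
have [g cg gc] := limit_coupling xa yb xM yM Wce cce.
exact: (Wp_pow_le p0 cg gc).
Qed.

End ultrafilter.

Lemma cvg_nat_ultra (U : set_system nat) (u : nat -> R) (l : R) :
  \oo `<=` U -> u @ \oo --> l -> u @ U --> l.
Proof. by move=> sU; apply: cvg_trans; exact: cvg_app. Qed.

Lemma cvg_succ_inv : (fun n => n.+1%:R^-1 : R) @ \oo --> (0 : R).
Proof.
apply/cvgrPdist_lt => e e0; near=> n.
rewrite sub0r normrN ger0_norm// -div1r ltr_pdivrMr//.
rewrite -ltr_pdivrMl// mulr1; apply: lt_trans (truncnS_gt _) _.
rewrite ltr_nat ltnS; near: n; exact: nbhs_infty_gt.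
Unshelve. all: by end_near. Qed.

(** Apply [limit_coupling] to constant sequences with bounds tending to 0: the resulting coupling
    has cost 0, hence is concentrated on the diagonal. *)
Lemma Wp_eq0_law (a b : Pp d p) : Wp a b = 0 ->
  forall A : set X, measurable A -> law a A = law b A.
Proof.
move=> ab0; have [U UU sU] := nat_ultrafilter.
pose M := Num.max (moment a) (moment b).
have cst_limit (z : Pp d p) : narrow_limit U (fun=> z) z by move=> f B _ _; exact: cvg_cst.
have Wc (n : nat) : Wp a b `^ p < n.+1%:R^-1 by rewrite ab0 powR0 ?gt_eqF// invr_gt0.
have [g cg g0] := @limit_coupling _ U UU (fun=> a) (fun=> b) a b M _ 0
  (cst_limit a) (cst_limit b) (fun=> ltac:(by rewrite le_max lexx))
  (fun=> ltac:(by rewrite le_max lexx orbT)) Wc (cvg_nat_ultra sU cvg_succ_inv).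
pose cost (z : X * X) : \bar R := (enorm ((z.1 : rV) - z.2) `^ p)%:E.
have mcost : measurable_fun setT cost.
  by apply/measurable_EFinP; apply: measurable_powR_comp; exact: measurable_dist.
have ae0 : ae_eq g setT cost (cst 0%E).
  apply/ae_eq_integral_abs => //; apply/eqP; rewrite eq_le integral_ge0// andbT.
  apply: le_trans g0; rewrite le_eqVlt; apply/orP; left; apply/eqP.
  by apply: eq_integral => z _; rewrite gee0_abs// lee_fin powR_ge0.
apply: bounded_continuous_eq => f cf /bounded_fun_le[B fB].
have mf := continuous_borel_fun cf.
rewrite -(Rintegral_coupling1 cg mf fB) -(Rintegral_coupling2 cg mf fB).
have meas (s : X * X -> X) : measurable_fun setT s -> measurable_fun setT (EFin \o (f \o s)).
  by move=> ms; apply/measurable_EFinP; exact: measurableT_comp.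
congr fine; apply: ae_eq_integral => //.
- exact: (meas _ measurable_fst).
- exact: (meas _ measurable_snd).
apply: filterS ae0 => z /= /(_ Logic.I) [] /powR_eq0_eq0 /enorm_eq0 /eqP.
by rewrite subr_eq0 => /eqP ->.
Qed.

(** Elements of [Pp d p] whose laws agree on Borel sets need not be equal, and distance 0 gives no
    more than such agreement. Limits and distances are transported along it here and in [Wp_law]. *)
Lemma narrow_limit_law (I : Type) (U : set_system I) (x : I -> Pp d p) (a b : Pp d p) :
  (forall A : set X, measurable A -> law a A = law b A) ->
  narrow_limit U x a -> narrow_limit U x b.
Proof.
move=> ab xa f B cf fB; rewrite [X in _ --> X](_ : _ = \int[a]_z f z).
  exact: xa cf fB.
by congr fine; apply: eq_measure_integral => A mA _; exact/esym/ab.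
Qed.

Lemma Wp_law (a b c : Pp d p) :
  (forall A : set X, measurable A -> law a A = law b A) -> Wp a c = Wp b c.
Proof.
move=> ab; rewrite /Wp (_ : coupling a c = coupling b c)//.
by apply/seteqP; split => g [g1 g2]; split => // A mA; rewrite g1// ab.
Qed.

(* Along an ultrafilter the pairs [(x, y)] of a violating sequence have narrow
   limits with the same law. *)
Lemma narrow_uniformly_continuous (F : Pp d p -> R) (M e : R) :
  narrow_continuous F -> 0 < e ->
  exists2 delta, 0 < delta & forall x y, moment x <= M -> moment y <= M ->
    Wp x y < delta -> `|F x - F y| < e.
Proof.
move=> cF e0; apply: contrapT => H.
have h (n : nat) : {z : Pp d p * Pp d p | [/\ moment z.1 <= M, moment z.2 <= M,
    Wp z.1 z.2 `^ p <= n.+1%:R^-1 & e <= `|F z.1 - F z.2|]}.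
  apply: cid; apply: contrapT => Hn; apply: H.
  exists (n.+1%:R^-1 `^ p^-1); first by rewrite powR_gt0// invr_gt0.
  move=> x y xM yM xy; rewrite ltNge; apply/negP => exy; apply: Hn.
  exists (x, y); split => //=.
  rewrite -[leRHS](_ : (n.+1%:R^-1 `^ p^-1) `^ p = _).
    by apply: ge0_ler_powR; rewrite ?nnegrE ?powR_ge0 ?Wp_ge0//; exact: ltW.
  by rewrite -powRrM mulVf ?gt_eqF// powRr1// invr_ge0.
have [U UU sU] := nat_ultrafilter.
pose x n := (sval (h n)).1; pose y n := (sval (h n)).2.
have xM n : moment (x n) <= M by case: (svalP (h n)).
have yM n : moment (y n) <= M by case: (svalP (h n)).
have xyW n : Wp (x n) (y n) `^ p <= n.+1%:R^-1 by case: (svalP (h n)).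
have xyF n : e <= `|F (x n) - F (y n)| by case: (svalP (h n)).
have [a xa aM] := narrow_compact UU xM.
have [b yb bM] := narrow_compact UU yM.
have ab0 : Wp a b = 0.
  apply: (Wp_pow_le0 (p := p)).
  exact: (Wp_narrow_lsc UU xa yb xM yM xyW (cvg_nat_ultra sU cvg_succ_inv)).
have ya : narrow_limit U y a.
  by apply: narrow_limit_law yb => A mA; apply/esym; exact: Wp_eq0_law.
have Fx := narrow_limit_continuous UU cF xa.
have Fy := narrow_limit_continuous UU cF ya.
have H0 : (fun n => `|F (x n) - F (y n)|) @ U --> (0 : R).
  by rewrite -(normr0 R) -(subrr (F a)); exact: cvg_norm (cvgB Fx Fy).
have : e <= 0 by apply: (cvgr_to_ge H0); apply: nearW => n; exact: xyF.
by rewrite leNgt e0.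
Qed.

End narrow_limits.

(** * Weak limits in L^p *)

Section powR_inequalities.
Context (R : realType) (p : R).
Hypothesis p1 : 1 < p.

Let p0 : 0 < p. Proof. exact: lt_trans ltr01 p1. Qed.

Let p10 : 0 < p - 1. Proof. by rewrite subr_gt0. Qed.

(** The convex function [y ^ p] lies above its tangent at [v]; this is Young's inequality for [y]
    and [v ^ (p - 1)] with exponents [p] and [p / (p - 1)]. *)
Lemma powR_tangent (y v : R) : 0 <= y -> 0 <= v ->
  p * (v `^ (p - 1) * y) <= y `^ p + (p - 1) * v `^ p.
Proof.
move=> y0 v0.
have q0 : 0 < p / (p - 1) by rewrite divr_gt0.
have pq : p^-1 + (p / (p - 1))^-1 = 1 by field; rewrite !gt_eqF.
have := conjugate_powR y0 (powR_ge0 v (p - 1)) p0 q0 pq.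
rewrite -powRrM (_ : (p - 1) * (p / (p - 1)) = p); last by field; rewrite gt_eqF.
move=> /(ler_wpM2l (ltW p0)); rewrite (mulrC y) => /le_trans; apply.
by rewrite le_eqVlt; apply/orP; left; apply/eqP; field; rewrite !gt_eqF.
Qed.

(** Beyond [l] one has [y ^ p = y * y ^ (p - 1) >= y * l ^ (p - 1)]. Once integrated, this turns a
    bound in [L^p] into uniform integrability, since the last term is small for large [l]. *)
Lemma powR_truncation (y l : R) : 0 <= y -> 0 < l ->
  y <= l + y `^ p / l `^ (p - 1).
Proof.
move=> y0 l0; have lp0 : 0 < l `^ (p - 1) by rewrite powR_gt0.
have [yl|ly] := leP y l; first by rewrite ler_wpDr// divr_ge0 ?powR_ge0// ltW.
apply: ler_wpDl; first exact: ltW.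
rewrite ler_pdivlMr// -(mulr_powRB1 y0 p0).
rewrite ler_wpM2l//; apply: ge0_ler_powR; rewrite ?nnegrE//; exact: ltW.
Qed.

Lemma exists_truncation (M e : R) : 0 <= M -> 0 < e ->
  exists2 l : R, 0 < l & M / l `^ (p - 1) <= e.
Proof.
move=> M0 e0.
have Me : 0 < (M + 1) / e by rewrite divr_gt0// ltr_wpDl.
exists (((M + 1) / e) `^ (p - 1)^-1); first by rewrite powR_gt0.
rewrite -powRrM mulVf ?gt_eqF// powRr1 ?(ltW Me)//.
by rewrite ler_pdivrMr// mulrCA divff ?gt_eqF// mulr1 lerDl.
Qed.

End powR_inequalities.

Section weak_limit.
Context d (T : measurableType d) (R : realType).
Context (mu : {sigma_finite_measure set T -> \bar R}) (D : set T).
Context (mD : measurable D) (muD : (mu D < +oo)%E).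
Context (I : Type) (U : set_system I) (UU : UltraFilter U).
Context (p : R) (p1 : 1 < p) (M : R).
Context (g : I -> T -> R) (mg : forall i, measurable_fun D (g i)).
Context (g0 : forall i x, D x -> 0 <= g i x).
Context (gM : forall i, (\int[mu]_(x in D) (g i x `^ p)%:E <= M%:E)%E).

Let M0 : 0 <= M.
Proof.
have [i _] := filter_ex (@filterT _ U _).
rewrite -lee_fin; apply: le_trans (gM i).
by apply: integral_ge0 => x _; rewrite lee_fin powR_ge0.
Qed.

Let muDA_fin A : measurable A -> mu (D `&` A) \is a fin_num.
Proof.
move=> mA; rewrite ge0_fin_numE//.
exact: le_lt_trans (measureIl _ mD mA) muD.
Qed.

Let gp_integrable i : mu.-integrable D (EFin \o (fun x => g i x `^ p)).
Proof.
apply/integrableP; split.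
  by apply/measurable_EFinP; exact: measurable_powR_comp.
under eq_integral => x _ do rewrite /= ger0_norm ?powR_ge0//.
exact: le_lt_trans (gM i) (ltry _).
Qed.

Lemma le_integral_truncation i A (l : R) : measurable A -> 0 < l ->
  (\int[mu]_(x in D `&` A) (g i x)%:E <=
    (l * fine (mu (D `&` A)) + M / l `^ (p - 1))%:E)%E.
Proof.
move=> mA l0; have mDA : measurable (D `&` A) by exact: measurableI.
have lp0 : 0 < l `^ (p - 1) by rewrite powR_gt0.
have mgp : measurable_fun (D `&` A) (fun x => g i x `^ p).
  by apply: measurable_powR_comp; apply: measurable_funS (mg i).
have ml : measurable_fun (D `&` A) (fun x : T => (cst l x)%:E).
  by apply/measurable_EFinP; exact: measurable_cst.
apply: (@le_trans _ _ (\int[mu]_(x in D `&` A)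
    ((cst l x)%:E + (l `^ (p - 1))^-1%:E * (g i x `^ p)%:E))%E).
  apply: ge0_le_integral => //.
  - by move=> x [Dx _]; rewrite lee_fin g0.
  - by apply/measurable_EFinP; apply: measurable_funS (mg i).
  - apply: emeasurable_funD => //.
    by apply: measurable_funeM; exact/measurable_EFinP.
  - move=> x [Dx _]; rewrite -EFinM -EFinD lee_fin mulrC.
    exact: powR_truncation p1 _ _ (g0 i Dx) l0.
rewrite ge0_integralD//; last 3 first.
- by move=> x _; rewrite lee_fin ltW.
- by move=> x _; rewrite -EFinM lee_fin mulr_ge0 ?powR_ge0// invr_ge0 ltW.
- by apply: measurable_funeM; exact/measurable_EFinP.
rewrite (_ : (\int[mu]_(x in D `&` A) (cst l x)%:E = l%:E * mu (D `&` A))%E);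
  last by have := integral_cst mu mDA l%:E; exact.
rewrite EFinD; apply: leeD.
  by rewrite EFinM fineK// muDA_fin.
rewrite ge0_integralZl_EFin//; last 3 first.
- by move=> x _; rewrite lee_fin powR_ge0.
- exact/measurable_EFinP.
- by rewrite invr_ge0 ltW.
rewrite mulrC EFinM; apply: lee_wpmul2l; first by rewrite lee_fin invr_ge0 ltW.
apply: le_trans (gM i); apply: ge0_subset_integral => //.
- by apply/measurable_EFinP; exact: measurable_powR_comp.
- by move=> x _; rewrite lee_fin powR_ge0.
Qed.

Let u i A : R := \int[mu]_(x in D `&` A) g i x.

Let uE i A : measurable A -> (\int[mu]_(x in D `&` A) (g i x)%:E = (u i A)%:E)%E.
Proof.
move=> mA; rewrite fineK// ge0_fin_numE; last first.
  by apply: integral_ge0 => x [Dx _]; rewrite lee_fin g0.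
exact: le_lt_trans (le_integral_truncation i mA ltr01) (ltry _).
Qed.

Let u_ge0 i A : measurable A -> 0 <= u i A.
Proof.
by move=> mA; rewrite -lee_fin -uE//; apply: integral_ge0 => x [Dx _]; rewrite lee_fin g0.
Qed.

Let u_le i A l : measurable A -> 0 < l ->
  u i A <= l * fine (mu (D `&` A)) + M / l `^ (p - 1).
Proof. by move=> mA l0; rewrite -lee_fin -uE//; exact: le_integral_truncation. Qed.

Definition limit_charge (A : set T) : R := lim ((fun i => u i A) @ U).
Local Notation nu := limit_charge.

Lemma limit_charge_cvg A : measurable A -> (fun i => u i A) @ U --> nu A.
Proof.
move=> mA.
apply: (@ultra_bounded_cvg R I U UU _ 0 (1 * fine (mu (D `&` A)) + M / 1 `^ (p - 1))).
by move=> i; rewrite u_ge0//= u_le.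
Qed.

Let nu_ge0 A : measurable A -> 0 <= nu A.
Proof. by move=> mA; apply: (cvgr_to_ge (limit_charge_cvg mA)); apply: nearW => i; exact: u_ge0. Qed.

Let nu_le A l : measurable A -> 0 < l ->
  nu A <= l * fine (mu (D `&` A)) + M / l `^ (p - 1).
Proof.
by move=> mA l0; apply: (cvgr_to_le (limit_charge_cvg mA)); apply: nearW => i; exact: u_le.
Qed.

Let nuU A B : measurable A -> measurable B -> A `&` B = set0 -> nu (A `|` B) = nu A + nu B.
Proof.
move=> mA mB AB0; apply: cvg_lim => //.
rewrite (_ : (fun i => _) = (fun i => u i A) + (fun i => u i B)).
  exact: cvgD (limit_charge_cvg mA) (limit_charge_cvg mB).
apply/funext => i; apply: EFin_inj; rewrite !fctE EFinD -!uE//; last exact: measurableU.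
rewrite setIUr ge0_integral_setU//; [exact: measurableI|exact: measurableI| | |].
- by apply/measurable_EFinP; rewrite -setIUr; apply: measurable_funS (mg i).
- by rewrite -setIUr => x [Dx _]; rewrite lee_fin g0.
- by apply/disj_set2P; rewrite setIACA AB0 setI0.
Qed.

Let nu0 : nu set0 = 0.
Proof.
by have := nuU measurable0 measurable0 (setI0 _); rewrite setU0; lra.
Qed.

Let nu_bigsetU (F : (set T)^nat) n : (forall k, measurable (F k)) -> trivIset setT F ->
  nu (\big[setU/set0]_(k < n) F k) = \sum_(k < n) nu (F k).
Proof.
move=> mF tF; elim: n => [|n IHn]; first by rewrite !big_ord0.
rewrite !big_ord_recr/= -IHn nuU//; first exact: bigsetU_measurable.
by apply: (@trivIset_bigsetUI _ predT) => //; rewrite /predT /= trueE.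
Qed.

(** By finite additivity the defect is the value on the tail [E n]. Its [mu]-measure inside [D]
    tends to 0, and [nu_le], with [l] chosen from [e] alone, makes the value small: uniform
    integrability is what the setwise limit lacks in general. *)
Let nu_sigma_additive : semi_sigma_additive (fun A => (nu A)%:E : \bar R).
Proof.
move=> F mF tF mUF.
rewrite (_ : (fun n => _) = EFin \o (fun n => nu (\big[setU/set0]_(k < n) F k))); last first.
  by apply/funext => n /=; rewrite big_mkord sumEFin nu_bigsetU.
apply: cvg_EFin; first exact: nearW.
pose E n := (\bigcup_k F k) `\` \big[setU/set0]_(k < n) F k.
have mB n : measurable (\big[setU/set0]_(k < n) F k) by exact: bigsetU_measurable.
have mE n : measurable (E n) by exact: measurableD.
have nuE n : nu (\bigcup_k F k) = nu (\big[setU/set0]_(k < n) F k) + nu (E n).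
  rewrite -nuU//; last by rewrite /E setDE setICA setICr setI0.
  by rewrite setDUK// => x; rewrite -bigcup_mkord => -[k _ Fk]; exists k.
have E0 : mu (D `&` E n) @[n --> \oo] --> (0 : \bar R)%E.
  rewrite -(measure0 mu) (_ : set0 = \bigcap_n (D `&` E n)); last first.
    apply/esym/seteqP; split => // x DEx; have [_ [[k _ Fkx] _]] := DEx 0%N Logic.I.
    have [_ [_]] := DEx k.+1 Logic.I; apply.
    by rewrite -bigcup_mkord; exists k => /=.
  apply: nonincreasing_cvg_mu => //.
  - exact: le_lt_trans (measureIl _ mD (mE 0%N)) muD.
  - by move=> n; exact: measurableI.
  - by apply: bigcapT_measurable => n; exact: measurableI.
  - move=> m n mn; apply/subsetPset => x [Dx [Fx nF]]; split => //; split => //.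
    move=> Fm; apply: nF; move: Fm; rewrite -!bigcup_mkord => -[k /= km Fk].
    by exists k => //=; exact: leq_trans mn.
apply/cvgrPdist_le => e e0.
have e20 : 0 < e / 2 by lra.
have [l l0 Ml] := exists_truncation p1 M0 e20.
have el : 0 < e / 2 / l by rewrite divr_gt0.
have := E0 => /fine_cvgP[_ /cvgrPdist_lt/(_ _ el)]; apply: filterS => n /=.
rewrite sub0r normrN ger0_norm ?fine_ge0// => En.
rewrite (nuE n) addrAC subrr add0r ger0_norm ?nu_ge0//.
apply: le_trans (nu_le (mE n) l0) _.
by rewrite ltr_pdivlMr// mulrC in En; lra.
Qed.

(* The maximum only matters on non-measurable sets, where [limit_charge] is
   unspecified but a measure must be nonnegative. *)
Definition limit_measure (A : set T) : \bar R := (Num.max 0 (nu A))%:E.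

Let limit_measureE A : measurable A -> limit_measure A = (nu A)%:E.
Proof. by move=> mA; rewrite /limit_measure max_r// nu_ge0. Qed.

Let limit_measure0 : limit_measure set0 = 0%E.
Proof. by rewrite limit_measureE// nu0. Qed.

Let limit_measure_ge0 A : (0 <= limit_measure A)%E.
Proof. by rewrite lee_fin le_max lexx. Qed.

Let limit_measure_sigma_additive : semi_sigma_additive limit_measure.
Proof.
move=> F mF tF mUF; rewrite limit_measureE//.
under eq_fun do under eq_bigr do rewrite limit_measureE//.
exact: nu_sigma_additive.
Qed.

HB.instance Definition _ := isMeasure.Build _ _ _ limit_measure
  limit_measure0 limit_measure_ge0 limit_measure_sigma_additive.

Let limit_measure_finite : fin_num_fun limit_measure.
Proof. by []. Qed.

HB.instance Definition _ := Measure_isFinite.Build _ _ _ limit_measure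
  limit_measure_finite.

Lemma limit_measure_dominates : limit_measure `<< mu.
Proof.
apply/null_content_dominatesP => A mA muA0; rewrite limit_measureE//; congr EFin.
have muDA0 : mu (D `&` A) = 0%E.
  by apply/eqP; rewrite eq_le measure_ge0 andbT -muA0 measureIr.
apply/eqP; rewrite eq_le nu_ge0// andbT; apply/ler_addgt0Pr => e e0.
have [l l0 Ml] := exists_truncation p1 M0 e0.
by rewrite add0r; apply: le_trans (nu_le mA l0) _; rewrite muDA0 mulr0 add0r.
Qed.

Lemma limit_density : exists h : T -> R, [/\ forall x, 0 <= h x,
  mu.-integrable setT (EFin \o h) &
  forall A, measurable A ->
    (fun i => \int[mu]_(x in D `&` A) g i x) @ U --> \int[mu]_(x in A) h x].
Proof.
have dom := limit_measure_dominates.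
pose f := Radon_Nikodym_SigmaFinite.f (limit_measure : {finite_measure set T -> \bar R}) mu.
have f0 x : (0 <= f x)%E by exact: Radon_Nikodym_SigmaFinite.f_ge0.
have ff x : f x \is a fin_num by exact: Radon_Nikodym_SigmaFinite.f_fin_num.
have fE : EFin \o (fine \o f) = f by apply/funext => x /=; rewrite fineK.
exists (fine \o f); split => [x||A mA].
- exact: fine_ge0.
- by rewrite fE; exact: Radon_Nikodym_SigmaFinite.f_integrable.
- have -> : \int[mu]_(x in A) (fine \o f) x = nu A.
    transitivity (fine (limit_measure A)); last by rewrite limit_measureE.
    congr fine; under eq_integral do rewrite /= fineK//.
    exact/esym/Radon_Nikodym_SigmaFinite.f_integral.
  exact: limit_charge_cvg.
Qed.

End weak_limit.

Section weak_limit_norm.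
Context d (T : measurableType d) (R : realType).
Context (mu : {sigma_finite_measure set T -> \bar R}) (D : set T).
Context (mD : measurable D) (muD : (mu D < +oo)%E).
Context (I : Type) (U : set_system I) (UU : UltraFilter U).
Context (p : R) (p1 : 1 < p).
Context (g : I -> T -> R) (mg : forall i, measurable_fun D (g i)).
Context (g0 : forall i x, D x -> 0 <= g i x).
Context (c : I -> R) (c0 : R) (cc0 : c @ U --> c0).
Context (gc : forall i, (\int[mu]_(x in D) (g i x `^ p)%:E <= (c i)%:E)%E).
Context (h : T -> R) (h0 : forall x, 0 <= h x).
Context (hi : mu.-integrable setT (EFin \o h)).
Context (gh : forall A, measurable A ->
  (fun i => \int[mu]_(x in D `&` A) g i x) @ U --> \int[mu]_(x in D `&` A) h x).

Let p0 : 0 < p. Proof. exact: lt_trans ltr01 p1. Qed.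

Let muDA_fin A : measurable A -> mu (D `&` A) \is a fin_num.
Proof.
move=> mA; rewrite ge0_fin_numE//; exact: le_lt_trans (measureIl _ mD mA) muD.
Qed.

Let g_integrable i A : measurable A -> mu.-integrable (D `&` A) (EFin \o g i).
Proof.
move=> mA; apply/integrableP; split.
  by apply/measurable_EFinP; apply: measurable_funS (mg i).
have := @le_integral_truncation _ _ _ mu D mD muD I p p1 (c i) (fun=> g i)
  (fun=> mg i) (fun=> g0 i) (fun=> gc i) i A 1 mA ltr01.
move=> /le_lt_trans/(_ (ltry _)); apply: le_lt_trans.
rewrite le_eqVlt; apply/orP; left; apply/eqP; apply: eq_integral.
by move=> x /set_mem[Dx _] /=; rewrite ger0_norm// g0.
Qed.

Let gp_integrable i : mu.-integrable D (EFin \o (fun x => g i x `^ p)).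
Proof.
apply/integrableP; split.
  by apply/measurable_EFinP; exact: measurable_powR_comp.
under eq_integral => x _ do rewrite /= ger0_norm ?powR_ge0//.
exact: le_lt_trans (gc i) (ltry _).
Qed.

Let cst_integral A (k : R) : measurable A ->
  (\int[mu]_(x in D `&` A) (cst k x)%:E = (k * fine (mu (D `&` A)))%:E)%E.
Proof.
move=> mA; have mDA : measurable (D `&` A) by exact: measurableI.
have := integral_cst mu mDA k%:E; rewrite EFinM fineK ?muDA_fin//; exact.
Qed.

Let cst_Rintegral A (k : R) : measurable A ->
  k * fine (mu (D `&` A)) = \int[mu]_(x in D `&` A) (cst k x).
Proof. by move=> mA; rewrite /Rintegral cst_integral. Qed.

Let cst_integrable A (k : R) : measurable A ->
  mu.-integrable (D `&` A) (EFin \o cst k).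
Proof.
move=> mA; apply/integrableP; split.
  by apply/measurable_EFinP; exact: measurable_cst.
by have := cst_integral `|k| mA; rewrite /= => ->; exact: ltry.
Qed.

Let level_le i A v : measurable A -> 0 <= v ->
  p * v `^ (p - 1) * \int[mu]_(x in D `&` A) g i x <=
  \int[mu]_(x in D `&` A) (g i x `^ p) + (p - 1) * v `^ p * fine (mu (D `&` A)).
Proof.
move=> mA v0; have mDA : measurable (D `&` A) by exact: measurableI.
have gpi : mu.-integrable (D `&` A) (EFin \o (fun x => g i x `^ p)).
  by apply: (integrableS mD mDA _ (gp_integrable i)); exact: subIsetl.
have ci := cst_integrable ((p - 1) * v `^ p) mA.
rewrite (cst_Rintegral _ mA).
rewrite -RintegralD// -RintegralZl//; last exact: g_integrable.
apply: le_Rintegral => //.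
- rewrite (_ : EFin \o _ = (fun x => (p * v `^ (p - 1))%:E * (g i x)%:E)%E).
    by apply: integrableZl => //; exact: g_integrable.
  by apply/funext => x /=; rewrite EFinM.
- rewrite (_ : EFin \o _ = (fun x => (g i x `^ p)%:E + ((p - 1) * v `^ p)%:E)%E).
    exact: integrableD.
  by apply/funext => x /=; rewrite EFinD.
- by move=> x [Dx _]; rewrite -mulrA; exact: powR_tangent p1 _ _ (g0 i Dx) v0.
Qed.

Import HBNNSimple.

(* Summing over the level sets [psi = v] the tangent inequality at [v] and
   passing to the limit, where [int h >= v * mu] on each level set. *)
Let simple_le (psi : {nnsfun T >-> R}) : (forall x, psi x <= h x) ->
  (\int[mu]_(x in D) (psi x `^ p)%:E <= c0%:E)%E.
Proof.
move=> psih; pose s := fset_set (range psi).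
pose A (v : R) := psi @^-1` [set v].
have mA v : measurable (A v) by exact: measurable_funPTI.
have mDA v : measurable (D `&` A v) by exact: measurableI.
have us : uniq s by exact: fset_uniq.
have tA : trivIset [set` s] (fun v => D `&` A v).
  by apply/trivIsetP => v w _ _ vw; rewrite setIACA setIid -preimage_setI;
    apply/seteqP; split => // x [_ [/= e1 e2]]; move: vw; rewrite -e1 -e2 eqxx.
have DE : D = \big[setU/set0]_(v <- s) (D `&` A v).
  rewrite -bigcup_fset; apply/seteqP; split => [x Dx|x [v _ []]//].
  by exists (psi x) => //=; rewrite in_fset_set//; apply: mem_set; exists x.
have s0 v : v \in s -> 0 <= v.
  by rewrite in_fset_set// => /set_mem[x _ <-].
have split_levels (f : T -> R) : measurable_fun D f -> (forall x, D x -> 0 <= f x) ->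
    (\int[mu]_(x in D) (f x)%:E = \sum_(v <- s) \int[mu]_(x in D `&` A v) (f x)%:E)%E.
  move=> mf f0; rewrite [in LHS]DE ge0_integral_bigsetU// -DE//.
  exact/measurable_EFinP.
have mgp i : measurable_fun D (fun x => g i x `^ p) by exact: measurable_powR_comp.
(* The integral over a level set of the tangent to [y ^ p] at [v], evaluated at [g i]. It bounds the
   energy there from below and is affine in [g i], so it passes to the limit. *)
pose w i v : R := p * v `^ (p - 1) * \int[mu]_(x in D `&` A v) g i x -
  (p - 1) * v `^ p * fine (mu (D `&` A v)).
have wc i : \sum_(v <- s) w i v <= c i.
  rewrite -lee_fin; apply: le_trans (gc i).
  rewrite split_levels//; last by move=> x _; exact: powR_ge0.
  rewrite -sumEFin big_seq [leRHS]big_seq; apply: lee_sum => v vs.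
  have := level_le i (mA v) (s0 v vs); rewrite /w => hv.
  rewrite -[leRHS]fineK ?lee_fin ?lerBlDr//.
  apply: integrable_fin_num => //.
  by apply: (integrableS mD (mDA v) _ (gp_integrable i)); exact: subIsetl.
pose wl v : R := p * v `^ (p - 1) * \int[mu]_(x in D `&` A v) h x -
  (p - 1) * v `^ p * fine (mu (D `&` A v)).
have wlim : (fun i => \sum_(v <- s) w i v) @ U --> \sum_(v <- s) wl v.
  apply: cvg_big => [|v _]; first exact: add_continuous.
  apply: (@cvgB _ _ _ _ _ (fun i => p * v `^ (p - 1) * \int[mu]_(x in D `&` A v) g i x)
    (cst ((p - 1) * v `^ p * fine (mu (D `&` A v))))); last exact: cvg_cst.
  exact: (cvgMl_tmp (gh (mA v))).
have wlc : \sum_(v <- s) wl v <= c0 by exact: le_filter_lim wlim cc0 wc.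
apply: (@le_trans _ _ (\sum_(v <- s) wl v)%:E); last by rewrite lee_fin.
rewrite split_levels; last 2 first.
- by apply: measurable_powR_comp; exact: measurable_funTS.
- by move=> x _; exact: powR_ge0.
rewrite -sumEFin big_seq [leRHS]big_seq; apply: lee_sum => v vs.
have -> : (\int[mu]_(x in D `&` A v) (psi x `^ p)%:E =
    \int[mu]_(x in D `&` A v) (cst (v `^ p) x)%:E)%E.
  by apply: eq_integral => x /set_mem[_ /= ->].
rewrite cst_integral// lee_fin.
have v0 := s0 v vs.
have hv : v * fine (mu (D `&` A v)) <= \int[mu]_(x in D `&` A v) h x.
  rewrite (cst_Rintegral _ (mA v)).
  apply: le_Rintegral => //; first exact: cst_integrable.
    exact: (integrableS measurableT (mDA v)).
  by move=> x [_ /= <-]; exact: psih.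
have -> : v `^ p = v * v `^ (p - 1) by rewrite mulr_powRB1.
rewrite /wl -(mulr_powRB1 v0 p0).
have vp0 : 0 <= v `^ (p - 1) by exact: powR_ge0.
have := ler_wpM2l (mulr_ge0 (ltW p0) vp0) hv.
set m := fine _; set q := v `^ (p - 1); set H := \int[mu]_(x in _) _ => hH.
rewrite -subr_ge0; apply: (le_trans (y := p * q * H - p * q * (v * m))).
  by rewrite subr_ge0.
by rewrite le_eqVlt; apply/orP; left; apply/eqP; ring.
Qed.

(** The convergence is tested on sets only, which is enough for simple functions below [h]; monotone
    convergence then reaches [h]. *)
Lemma weak_limit_powR_le : (\int[mu]_(x in D) (h x `^ p)%:E <= c0%:E)%E.
Proof.
have mh : measurable_fun setT (EFin \o h) by exact: measurable_int hi.
have hE0 x : setT x -> (0 <= (EFin \o h) x)%E by move=> _; rewrite lee_fin.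
pose psi := nnsfun_approx measurableT mh.
have psi_cvg x : (fun n => psi n x) @ \oo --> h x.
  have /= := cvg_nnsfun_approx measurableT mh hE0 (x := x) Logic.I.
  by move=> /fine_cvgP[_]; exact.
have psi_nd m n x : (m <= n)%N -> psi m x <= psi n x.
  by move=> mn; have := nd_nnsfun_approx measurableT mh mn => /lefP; exact.
have psi_le n x : psi n x <= h x.
  apply: (cvgr_to_ge (psi_cvg x)); near=> m.
  by apply: psi_nd; near: m; exact: nbhs_infty_ge.
have mpsi n : measurable_fun D (fun x => (psi n x `^ p)%:E).
  by apply/measurable_EFinP; apply: measurable_powR_comp; exact: measurable_funTS.
have cv : (fun n => \int[mu]_(x in D) (psi n x `^ p)%:E)%E @ \oo -->
    (\int[mu]_(x in D) (limn (fun n => (psi n x `^ p)%:E)))%E.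
  apply: cvg_monotone_convergence => //.
  - by move=> n x _; rewrite lee_fin powR_ge0.
  - move=> x _ m n mn; rewrite lee_fin; apply: ge0_ler_powR; rewrite ?nnegrE//.
      exact: ltW.
    exact: psi_nd.
have -> : (\int[mu]_(x in D) (h x `^ p)%:E =
    \int[mu]_(x in D) (limn (fun n => (psi n x `^ p)%:E)))%E.
  apply: eq_integral => x _; apply/esym/cvg_lim => //.
  apply: cvg_EFin; first exact: nearW.
  have cp : {for h x, continuous (fun a : R => `|a| `^ p)}.
    exact: norm_powR_continuous.
  have e : (fun n => psi n x `^ p) = (fun a : R => `|a| `^ p) \o (fun n => psi n x).
    by apply/funext => n /=; rewrite ger0_norm.
  have := continuous_cvg _ cp (psi_cvg x).
  by rewrite (ger0_norm (h0 x)) -e; apply; exact: eventually_filter.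
rewrite -(cvg_lim _ cv)//; apply: lime_le; first by apply/cvg_ex; eexists; exact: cv.
by apply: nearW => n; apply: simple_le => x; exact: psi_le.
Unshelve. all: by end_near. Qed.

End weak_limit_norm.

(** * Integral comparison and sign of densities on an interval *)

Section measure_lemmas.
Context (R : realType).

(** The integral of a nonnegative function is a supremum over the simple functions below it, hence
    monotone as it stands. It is applied to the distance to the endpoint of a path. *)
Lemma le_integral_nonmeasurable d (T : measurableType d)
    (mu : {measure set T -> \bar R}) (D : set T) (f g : T -> \bar R) :
  (forall x, D x -> 0 <= f x)%E -> (forall x, D x -> f x <= g x)%E ->
  (\int[mu]_(x in D) f x <= \int[mu]_(x in D) g x)%E.
Proof.
move=> f0 fg; rewrite !(integral_mkcond D).
have fD0 x : (0 <= (f \_ D) x)%E by exact: erestrict_ge0.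
have fgD x : ((f \_ D) x <= (g \_ D) x)%E by exact: lee_restrict.
rewrite !ge0_integralTE//; last by move=> x; exact: le_trans (fgD x).
apply: ge_ereal_sup => _ [h hf <-]; apply: ereal_sup_ubound.
by exists h => // x; exact: le_trans (fgD x).
Qed.

Local Notation leb := (@lebesgue_measure R).

Lemma powR_integrable (D : set R) (p : R) (k : R -> R) : 1 < p ->
  measurable D -> (leb D < +oo)%E -> measurable_fun D k ->
  (\int[leb]_(s in D) (`|k s| `^ p)%:E < +oo)%E ->
  leb.-integrable D (EFin \o k).
Proof.
move=> p1 mD Dfin mk kp; apply/integrableP; split; first exact/measurable_EFinP.
have X : (\int[leb]_(s in D) (`|k s| `^ p)%:E <=
    (fine (\int[leb]_(s in D) (`|k s| `^ p)%:E))%:E)%E.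
  rewrite fineK// ge0_fin_numE//.
  by apply: integral_ge0 => x _; rewrite lee_fin powR_ge0.
have := @le_integral_truncation _ _ _ leb D mD Dfin unit p p1 _
  (fun=> fun s => `|k s|) (fun=> measurableT_comp (@normr_measurable R setT) mk)
  (fun=> fun s _ => normr_ge0 _) (fun=> X) tt setT 1 measurableT ltr01.
by rewrite setIT => /le_lt_trans; apply; exact: ltry.
Qed.

(** The primitive of [k] is nondecreasing on the interval, and by Lebesgue differentiation its
    derivative is [k] almost everywhere. *)
Lemma ge0_of_integral_itv (t : R) (k : R -> R) :
  leb.-integrable `[0, t] (EFin \o k) ->
  (forall a b, 0 <= a -> a <= b -> b <= t -> 0 <= \int[leb]_(s in `[a, b]) k s) ->
  {ae leb, forall s, s \in `[0, t] -> 0 <= k s}.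
Proof.
move=> ik k0.
pose f := k \_ `[0, t].
have mI : measurable (`[0, t]%classic : set R) by exact: measurable_itv.
have fi : leb.-integrable setT (EFin \o f).
  have : leb.-integrable setT ((EFin \o k) \_ `[0, t]).
    exact: (proj1 (@integrable_mkcond _ _ _ leb `[0, t]%classic (EFin \o k) mI) ik).
  by rewrite restrict_EFin.
have fiS (b : interval R) : leb.-integrable [set` b] (EFin \o f).
  by apply: integrableS fi => //; exact: measurable_itv.
have ae1 := @FTC1Ny R f (fun y => fiS `]-oo, y]) (open_integrable_locally openT fi).
have ae2 (x : R) : {ae leb, forall s, s != x}.
  exists [set x]; split => //; first exact: lebesgue_measure_set1.
  by move=> s /= /negP; rewrite negbK => /eqP.
(* Discarding the endpoints lets small increments of either sign remain in [[0, t]], where the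
   primitive is monotone. *)
have := ae2 0; have := ae2 t; move: ae1.
apply: filterS3; first exact: (ae_filter_ringOfSetsType leb).
move=> s [].
set F := (fun _ => _) => dF F's st s0; rewrite in_itv/= => /andP[s0' st'].
have {s0'}s0 : 0 < s by rewrite lt_neqAle eq_sym s0.
have {st'}st : s < t by rewrite lt_neqAle st.
have -> : k s = f s by rewrite /f patchE ifT//; apply: mem_set; rewrite /= in_itv/= !ltW.
rewrite -F's derive1E; apply: limr_ge; first exact: dF.
have Fle a b : 0 <= a -> a <= b -> b <= t -> F a <= F b.
  move=> a0 ab bt; rewrite -subr_ge0 /F (Rintegral_itvB (fiS `]-oo, b]))//.
  rewrite Rintegral_itv_obnd_cbnd; last exact: fiS.
  have -> : \int[leb]_(x in `[a, b]) f x = \int[leb]_(x in `[a, b]) k x.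
    2: exact: k0.
  apply: eq_Rintegral => x /set_mem; rewrite /= in_itv/= => /andP[ax xb].
  rewrite /f patchE ifT//; apply: mem_set.
  by rewrite /= in_itv/= (le_trans a0 ax) (le_trans xb bt).
near=> h; rewrite /= /GRing.scale/= mulr1.
have h1 : `|h| <= s by near: h; apply: dnbhs0_le.
have h2 : `|h| <= t - s by near: h; apply: dnbhs0_le; rewrite subr_gt0.
have [h0|h0] := leP 0 h.
  rewrite mulr_ge0 ?invr_ge0// subr_ge0; apply: Fle.
  - exact: ltW.
  - by rewrite lerDr.
  - by rewrite -lerBrDr -(ger0_norm h0).
rewrite nmulr_rge0 ?invr_lt0// subr_le0; apply: Fle; last exact: ltW.
  by rewrite ltr0_norm// in h1; lra.
by rewrite gerDr ltW.
Unshelve. all: by end_near. Qed.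

End measure_lemmas.

(** * Paths of finite energy *)

Section speed_bounds.
Context (R : realType) (d : nat) (p : R).
Hypothesis p1 : 1 < p.
Local Notation leb := (@lebesgue_measure R).
Implicit Types (t : R) (sigma : R -> Pp d p) (h : R -> R).

Let p0 : 0 < p. Proof. exact: lt_trans ltr01 p1. Qed.

Definition energy t h : \bar R := (\int[leb]_(s in `[0%R, t]) (`|h s| `^ p)%:E)%E.

Lemma energy_ge0 t h : (0 <= energy t h)%E.
Proof. by apply: integral_ge0 => s _; rewrite lee_fin powR_ge0. Qed.

Lemma leb_itv_fin (a b : R) : (leb `[a, b] < +oo)%E.
Proof.
rewrite lebesgue_measure_itv/=; case: ifPn => _; last exact: ltry.
by rewrite -EFinB ltry.
Qed.

Lemma leb_itv (a b : R) : a <= b -> fine (leb `[a, b]) = b - a.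
Proof.
move=> ab; rewrite lebesgue_measure_itv/= lte_fin; case: ltP => // ba.
by apply/esym/eqP; rewrite subr_eq0 eq_le ba ab.
Qed.

Lemma Lp_on_integrable t h a b : Lp_on p t h -> 0 <= a -> b <= t ->
  leb.-integrable `[a, b] (EFin \o h).
Proof.
move=> [mh hp] a0 bt.
have ih : leb.-integrable `[0, t] (EFin \o h).
  by apply: powR_integrable p1 _ _ mh hp; [exact: measurable_itv|exact: leb_itv_fin].
apply: integrableS ih; [exact: measurable_itv|exact: measurable_itv|].
by apply: subset_itv; rewrite bnd_simp.
Qed.

(** Takes the place of Hoelder's inequality: optimising over [l] would give, up to a constant, the
    modulus [X ^ (1/p) * (s2 - s1) ^ (1 - 1/p)]. *)
Lemma Wp_le_truncation t sigma h (X l s1 s2 : R) : speed_bound t sigma h ->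
  (energy t h <= X%:E)%E -> 0 < l -> 0 <= s1 -> s1 <= s2 -> s2 <= t ->
  Wp (sigma s1) (sigma s2) <= l * (s2 - s1) + X / l `^ (p - 1).
Proof.
move=> [Lh Wh] hX l0 s10 s12 s2t; apply: le_trans (Wh _ _ s10 s12 s2t) _.
have ih := Lp_on_integrable Lh s10 s2t.
have mI : measurable (`[0, t]%classic : set R) by exact: measurable_itv.
have mJ : measurable (`[s1, s2]%classic : set R) by exact: measurable_itv.
apply: (@le_trans _ _ (\int[leb]_(s in `[s1, s2]) `|h s|)).
  by apply: (le_trans (ler_norm _)); exact: le_normr_Rintegral.
have IJ : `[0, t] `&` `[s1, s2] = `[s1, s2]%classic.
  apply/setIidPr => s; rewrite /= !in_itv/= => /andP[a b].
  by rewrite (le_trans s10 a) (le_trans b s2t).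
have := @le_integral_truncation _ _ _ leb `[0, t]%classic mI (leb_itv_fin 0 t) unit p p1 X
  (fun=> fun s => `|h s|) (fun=> measurableT_comp (@normr_measurable R setT) (proj1 Lh))
  (fun=> fun s _ => normr_ge0 _) (fun=> hX) tt `[s1, s2]%classic l mJ l0.
rewrite IJ leb_itv// -lee_fin; apply: le_trans.
rewrite fineK//; apply: integrable_fin_num => //.
exact: (integrable_norm ih).
Qed.

Lemma Wp_le_energy t sigma h (X s1 s2 : R) : speed_bound t sigma h ->
  (energy t h <= X%:E)%E -> 0 <= s1 -> s1 <= s2 -> s2 <= t ->
  Wp (sigma s1) (sigma s2) <= t + X.
Proof.
move=> sh hX s10 s12 s2t.
have := Wp_le_truncation sh hX ltr01 s10 s12 s2t.
by rewrite powR1 divr1 mul1r; lra.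
Qed.

Lemma moment_le_energy t sigma h (X s : R) : speed_bound t sigma h ->
  (energy t h <= X%:E)%E -> 0 <= s -> s <= t ->
  moment (sigma s) <= 2 `^ p * (t + X) `^ p + 2 `^ p * moment (sigma t).
Proof.
move=> sh hX s0 st.
have := moment_le_Wp p0 (sigma s) (sigma t) (l := 2).
have -> : 2 / (2 - 1) = 2 :> R by rewrite (_ : 2 - 1 = 1) ?divr1//; ring.
move=> /(_ (ltr1n R 2)) /le_trans; apply.
rewrite lerD2r ler_wpM2l ?powR_ge0//; apply: ge0_ler_powR; rewrite ?nnegrE ?Wp_ge0//.
- exact: ltW.
- exact: le_trans (Wp_ge0 _ _) (Wp_le_energy sh hX s0 st (lexx t)).
- exact: Wp_le_energy sh hX s0 st (lexx t).
Qed.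

Lemma speed_bound_equicontinuous (X e : R) : 0 <= X -> 0 < e ->
  exists2 delta, 0 < delta & forall t sigma h, speed_bound t sigma h ->
    (energy t h <= X%:E)%E -> forall s1 s2, 0 <= s1 -> s1 <= s2 -> s2 <= t ->
    s2 - s1 < delta -> Wp (sigma s1) (sigma s2) < e.
Proof.
move=> X0 e0; have e20 : 0 < e / 2 by lra.
have [l l0 Xl] := exists_truncation p1 X0 e20.
exists (e / 2 / l); first by rewrite divr_gt0.
move=> t sigma h sh hX s1 s2 s10 s12 s2t.
rewrite ltr_pdivlMr// => s12e.
apply: le_lt_trans (Wp_le_truncation sh hX l0 s10 s12 s2t) _.
by rewrite mulrC; lra.
Qed.

(** Small distances to [a] bound the moments, so a narrow limit [b] exists; lower semicontinuity
    puts [b] at distance 0 from [a]. *)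
Lemma Wp_cvg_narrow (U : set_system nat) (UU : UltraFilter U) (x : nat -> Pp d p)
    (a : Pp d p) : \oo `<=` U ->
  (forall n, Wp (x n) a `^ p <= n.+1%:R^-1) -> narrow_limit U x a.
Proof.
move=> sU xa.
pose M := 2 `^ p + 2 `^ p * moment a.
have p2 : 0 <= 2 `^ p :> R by exact: powR_ge0.
have p2' : 1 <= 2 `^ p :> R.
  have : 1 `^ p <= 2 `^ p :> R.
    by apply: ge0_ler_powR; rewrite ?nnegrE ?(ltW p0)// ler1n.
  by rewrite powR1.
have xM n : moment (x n) <= M.
  have := moment_le_Wp p0 (x n) a (l := 2).
  have -> : 2 / (2 - 1) = 2 :> R by rewrite (_ : 2 - 1 = 1) ?divr1//; ring.
  move=> /(_ (ltr1n R 2)) /le_trans; apply; rewrite lerD2r ler_piMr//.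
  by apply: le_trans (xa n) _; rewrite invf_le1// ler1n.
have aM : moment a <= M by have := moment_ge0 a; rewrite /M; nra.
have [b xb _] := narrow_compact p0 UU xM.
have cst_limit : narrow_limit U (fun=> a) a by move=> f B _ _; exact: cvg_cst.
have Wba : Wp b a = 0.
  apply: (Wp_pow_le0 (p := p)).
  exact: (Wp_narrow_lsc p0 UU xb cst_limit xM (fun=> aM) xa
    (cvg_nat_ultra sU (@cvg_succ_inv R))).
by apply: narrow_limit_law xb; exact: Wp_eq0_law.
Qed.

Lemma speed_bound_ge0 t sigma h : speed_bound t sigma h ->
  {ae leb, forall s, s \in `[0, t] -> 0 <= h s}.
Proof.
move=> [Lh Wh]; apply: ge0_of_integral_itv.
  exact: Lp_on_integrable Lh (lexx 0) (lexx t).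
by move=> a b a0 ab bt; apply: le_trans (Wh a b a0 ab bt); exact: Wp_ge0.
Qed.

Lemma speed_bound_norm t sigma h :
  speed_bound t sigma h -> speed_bound t sigma (fun s => `|h s|).
Proof.
move=> [[mh hp] Wh]; split.
  split; first exact: measurableT_comp (@normr_measurable R setT) mh.
  by under eq_integral do rewrite normr_id.
move=> s1 s2 s10 s12 s2t; apply: le_trans (Wh s1 s2 s10 s12 s2t) _.
have ih := Lp_on_integrable (conj mh hp) s10 s2t.
by apply: (le_trans (ler_norm _)); apply: le_normr_Rintegral => //; exact: measurable_itv.
Qed.

(** A substitute for continuity of the distance to the endpoint. Points violating it would approach
    [s0] closely enough for their images to converge narrowly to [sigma s0], and lower
    semicontinuity would contradict the factor [1/2]. *)
Lemma Wp_end_lsc t sigma h s0 : speed_bound t sigma h ->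
  0 <= s0 -> s0 <= t -> 0 < Wp (sigma s0) (sigma t) ->
  exists2 delta, 0 < delta & forall s, 0 <= s -> s <= t -> `|s - s0| < delta ->
    Wp (sigma s0) (sigma t) `^ p / 2 <= Wp (sigma s) (sigma t) `^ p.
Proof.
move=> sh s00 s0t w0; set w := Wp (sigma s0) (sigma t) `^ p.
have wp : 0 < w by rewrite powR_gt0.
pose X := fine (energy t h).
have hX : (energy t h <= X%:E)%E.
  by rewrite fineK// ge0_fin_numE ?energy_ge0//; case: sh => -[].
have X0 : 0 <= X by exact/fine_ge0/energy_ge0.
apply: contrapT => H.
have hs (n : nat) : {s : R | [/\ 0 <= s, s <= t, Wp (sigma s) (sigma s0) `^ p <= n.+1%:R^-1 &
    Wp (sigma s) (sigma t) `^ p <= w / 2]}.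
  apply: cid.
  have e0 : 0 < n.+1%:R^-1 `^ p^-1 :> R by rewrite powR_gt0// invr_gt0.
  have [delta delta0 dW] := speed_bound_equicontinuous X0 e0.
  apply: contrapT => Hn; apply: H; exists delta; first exact: delta0.
  move=> s s0' st sd.
  rewrite leNgt; apply/negP => sw; apply: Hn; exists s; refine (And4 s0' st _ (ltW sw)).
  rewrite -[leRHS](_ : (n.+1%:R^-1 `^ p^-1) `^ p = _); last first.
    by rewrite -powRrM mulVf ?gt_eqF// powRr1// invr_ge0.
  apply: ge0_ler_powR; rewrite ?nnegrE ?powR_ge0 ?Wp_ge0 ?(ltW p0)//.
  have [ss0|s0s] := leP s s0.
    apply/ltW/(dW t sigma h sh hX) => //.
    by move: sd; rewrite distrC ger0_norm// subr_ge0.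
  rewrite Wp_sym//; apply/ltW/(dW t sigma h sh hX) => //; first exact: ltW.
  by move: sd; rewrite gtr0_norm// subr_gt0.
have [U UU sU] := nat_ultrafilter.
pose s n := sval (hs n).
have s_ge0 n : 0 <= s n by case: (svalP (hs n)).
have s_le n : s n <= t by case: (svalP (hs n)).
have sW n : Wp (sigma (s n)) (sigma s0) `^ p <= n.+1%:R^-1 by case: (svalP (hs n)).
have sw n : Wp (sigma (s n)) (sigma t) `^ p <= w / 2 by case: (svalP (hs n)).
pose M := 2 `^ p * (t + X) `^ p + 2 `^ p * moment (sigma t).
have mM s' : 0 <= s' -> s' <= t -> moment (sigma s') <= M.
  exact: moment_le_energy sh hX.
have t0 : 0 <= t := le_trans s00 s0t.
have lim1 : narrow_limit U (fun n => sigma (s n)) (sigma s0) by exact: Wp_cvg_narrow.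
have lim2 : narrow_limit U (fun=> sigma t) (sigma t) by move=> f B _ _; exact: cvg_cst.
have cw : (fun=> w / 2) @ U --> w / 2 by exact: cvg_cst.
have := Wp_narrow_lsc p0 UU lim1 lim2 (fun n => mM _ (s_ge0 n) (s_le n))
  (fun=> mM _ t0 (lexx t)) sw cw.
by rewrite -/w leNgt ltr_pdivrMr// ltr_pMr// ltr1n.
Qed.

Lemma poincare_energy (C : R) t sigma : poincare_constant d p C -> 0 < t ->
  AC t sigma ->
  (\int[leb]_(s in `[0%R, t]) (Wp (sigma s) (sigma t) `^ p)%:E <=
    ((C * t) `^ p)%:E * energy t (metric_derivative t sigma))%E.
Proof.
move=> [C0 HC] t0 ACs; have := HC t sigma t0 ACs; rewrite -/(energy _ _).
set x := (\int[leb]_(s in _) _)%E; set y := energy _ _ => xy.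
have x0 : (0 <= x)%E by apply: integral_ge0 => s _; rewrite lee_fin powR_ge0.
have y0 : (0 <= y)%E by exact: energy_ge0.
have Ct0 : 0 <= C * t by rewrite mulr_ge0// ltW.
have K z : (0 <= z)%E -> ((z `^ p^-1) `^ p = z)%E.
  by move=> z0; rewrite -poweRrM mulVf ?gt_eqF// poweRe1.
rewrite -(K x x0) -[in leRHS](K y y0) -poweR_EFin -poweRM ?lee_fin ?poweR_ge0//.
apply: gt0_ler_poweR => //; first exact: ltW.
- by rewrite in_itv/= poweR_ge0 leey.
- by rewrite in_itv/= leey andbT mule_ge0 ?lee_fin ?poweR_ge0.
Qed.

(* If no metric derivative existed, the chosen representative would be the zero
   default; the Poincare inequality would then make the path constant, and a
   constant path does have a metric derivative. *)
Lemma metric_derivativeP (C : R) t sigma : poincare_constant d p C -> 0 < t ->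
  AC t sigma -> is_metric_derivative t sigma (metric_derivative t sigma).
Proof.
move=> HC t0 ACs.
have [ex|nex] := pselect (exists h, is_metric_derivative t sigma h).
  by have [h hh] := ex; exact: (@xgetPex _ (cst 0) [set h | is_metric_derivative t sigma h]).
have md0 : metric_derivative t sigma = cst 0.
  by rewrite /metric_derivative xgetPN// => h hh; apply: nex; exists h.
exfalso; apply: nex; exists (cst 0).
have [h sh] := ACs.
have int0 : (\int[leb]_(r in `[0%R, t]) (Wp (sigma r) (sigma t) `^ p)%:E <= 0)%E.
  apply: le_trans (poincare_energy HC t0 ACs) _; rewrite md0 /energy.
  under eq_integral do rewrite /= normr0 powR0 ?gt_eqF//.
  by rewrite integral0 mule0.
(* The integral alone gives vanishing almost everywhere at best. A positive distance at one time
   stays bounded below on an interval around it, which forces a positive integral. *)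
have W0 s : 0 <= s -> s <= t -> Wp (sigma s) (sigma t) = 0.
  move=> s0 st; apply: contrapT => /eqP Wn0.
  have Wpos : 0 < Wp (sigma s) (sigma t) by rewrite lt_neqAle eq_sym Wn0 Wp_ge0.
  have [delta delta0 dW] := Wp_end_lsc sh s0 st Wpos.
  pose w := Wp (sigma s) (sigma t) `^ p / 2.
  have wp : 0 < w by rewrite divr_gt0// powR_gt0.
  (* Clamping keeps the interval inside [[0, t]], nondegenerate because [0 < t]; the halves of
     [delta] make the distance to [s] strictly less than [delta]. *)
  pose a := Num.max 0 (s - delta / 2); pose b := Num.min t (s + delta / 2).
  have ab : a < b.
    by rewrite /a /b gt_max !lt_min; apply/andP; split; apply/andP; split; lra.
  have /andP[a0 asd] : (0 <= a) && (s - delta / 2 <= a) by rewrite /a !le_max !lexx orbT.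
  have /andP[bt bsd] : (b <= t) && (b <= s + delta / 2) by rewrite /b !ge_min !lexx orbT.
  have mI : measurable (`[0, t]%classic : set R) by exact: measurable_itv.
  have mJ : measurable (`[a, b]%classic : set R) by exact: measurable_itv.
  have wJ : ((w * (b - a))%:E <= 0)%E.
    apply: le_trans int0.
    apply: (@le_trans _ _ (\int[leb]_(r in `[0%R, t]) (w%:E * (\1_(`[a, b]%classic) r)%:E))%E).
      rewrite ge0_integralZl_EFin//.
      - rewrite integral_indic// (_ : `[a, b] `&` `[0, t] = `[a, b]%classic); last first.
          apply/setIidPl => r; rewrite /= !in_itv/= => /andP[ar rb].
          by rewrite (le_trans a0 ar) (le_trans rb bt).
        by rewrite EFinM -(leb_itv (ltW ab)) fineK// ge0_fin_numE// leb_itv_fin.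
      - by apply/measurable_EFinP; exact: measurable_indic.
      - exact: ltW.
    apply: le_integral_nonmeasurable => r Ir.
      by rewrite -EFinM lee_fin mulr_ge0 ?(ltW wp)// indicE ler0n.
    rewrite -EFinM lee_fin indicE; case: (boolP (r \in _)) => [/set_mem|_]; last first.
      by rewrite mulr0 powR_ge0.
    move: Ir; rewrite /= !in_itv/= mulr1 => /andP[rge0 rt] /andP[ar rb].
    by apply: dW => //; rewrite ltr_norml; apply/andP; split; lra.
  by move: wJ; rewrite lee_fin leNgt mulr_gt0// subr_gt0.
have Wss s1 s2 : 0 <= s1 -> s1 <= s2 -> s2 <= t -> Wp (sigma s1) (sigma s2) = 0.
  move=> s10 s12 s2t.
  (* [sigma s1] has the law of the endpoint, so the distance between two times is again a distance
     to the endpoint. *)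
  rewrite (Wp_law (sigma s2) (Wp_eq0_law p0 (W0 _ s10 (le_trans s12 s2t)))).
  by rewrite Wp_sym// W0// (le_trans s10 s12).
have sp0 : speed_bound t sigma (cst 0).
  split.
    split; first exact: measurable_cst.
    under eq_integral do rewrite /= normr0 powR0 ?gt_eqF//.
    by rewrite integral0.
  move=> s1 s2 s10 s12 s2t; rewrite Wss//.
  by apply: Rintegral_ge0.
by split => // k sk; exact: (speed_bound_ge0 sk).
Qed.

Lemma energy_metric_derivative_le (C : R) t sigma h : poincare_constant d p C -> 0 < t ->
  speed_bound t sigma h -> (energy t (metric_derivative t sigma) <= energy t h)%E.
Proof.
move=> HC t0 sh; have ACs : AC t sigma by exists h.
have [smd mdle] := metric_derivativeP HC t0 ACs.
have mE (k : R -> R) : Lp_on p t k ->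
    measurable_fun `[0, t] (fun s => (`|k s| `^ p)%:E).
  move=> [mk _]; apply/measurable_EFinP; apply: measurable_powR_comp.
  exact: measurableT_comp (@normr_measurable R setT) mk.
apply: ae_ge0_le_integral => //.
- by apply: mE; case: smd.
- by apply: mE; case: sh.
have := speed_bound_ge0 smd; have := mdle h sh.
apply: filterS2; first exact: (ae_filter_ringOfSetsType leb).
move=> s h1 h2 Is; have {}Is : s \in `[0, t] by [].
rewrite lee_fin; apply: ge0_ler_powR; rewrite ?nnegrE//; first exact: ltW.
by rewrite (ger0_norm (h2 Is)); apply: le_trans (h1 Is) (ler_norm _).
Qed.

End speed_bounds.

Section paths.
Context (R : realType) (d : nat) (p : R) (p1 : 1 < p).
Context (C : R) (HC : poincare_constant d p C) (t : R) (t0 : 0 < t) (mu : Pp d p).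
Context (V : Pp d p -> R) (V_narrow : narrow_continuous V).
Local Notation leb := (@lebesgue_measure R).
Implicit Types (sigma : R -> Pp d p) (h : R -> R).

Let p0 : 0 < p. Proof. exact: lt_trans ltr01 p1. Qed.

Let mI : measurable (`[0, t]%classic : set R).
Proof. exact: measurable_itv. Qed.

(** The energy bound and the common endpoint confine all these paths to one moment ball, on which
    [V] is uniformly continuous; [delta] is therefore the same for all of them. *)
Lemma equicontinuous_along_paths (X e : R) : 0 <= X -> 0 < e ->
  exists2 delta, 0 < delta & forall sigma h, speed_bound t sigma h ->
    (energy p t h <= X%:E)%E -> sigma t = mu ->
    forall s s', 0 <= s -> s <= t -> 0 <= s' -> s' <= t -> `|s - s'| < delta ->
    `|V (sigma s) - V (sigma s')| < e.
Proof.
move=> X0 e0; pose M := 2 `^ p * (t + X) `^ p + 2 `^ p * moment mu.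
have [eta eta0 VW] := narrow_uniformly_continuous p0 M V_narrow e0.
have [delta delta0 dW] := speed_bound_equicontinuous d p1 X0 eta0.
exists delta; first exact: delta0.
move=> sigma h sh hX st.
have mM s : 0 <= s -> s <= t -> moment (sigma s) <= M.
  by move=> s0 s1; rewrite /M -st; exact: moment_le_energy sh hX s0 s1.
have half s s' : 0 <= s -> s <= s' -> s' <= t -> s' - s < delta ->
    `|V (sigma s) - V (sigma s')| < e.
  move=> s0 ss' s't ssd; apply: VW.
  - exact: mM s0 (le_trans ss' s't).
  - exact: mM (le_trans s0 ss') s't.
  - exact: dW sh hX s s' s0 ss' s't ssd.
move=> s s' s0 s1 s'0 s'1.
have [ss'|s's] := leP s s'.
  by rewrite distrC ger0_norm ?subr_ge0// => ?; exact: half.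
by rewrite gtr0_norm ?subr_gt0// => ?; rewrite distrC; apply: half => //; exact: ltW.
Qed.

Lemma path_energy_le sigma h : speed_bound t sigma h ->
  (energy p t h <= (fine (energy p t h))%:E)%E.
Proof.
by move=> [[_ hp] _]; rewrite fineK// ge0_fin_numE// energy_ge0.
Qed.

Lemma path_continuous sigma h : speed_bound t sigma h -> sigma t = mu ->
  {within `[0, t]%classic, continuous (V \o sigma)}.
Proof.
move=> sh st; apply/subspace_continuousP => s; rewrite /= in_itv/= => /andP[s0 s1].
have X0 : 0 <= fine (energy p t h) by exact/fine_ge0/energy_ge0.
apply/cvgrPdist_lt => e e0.
have [delta delta0 dV] := equicontinuous_along_paths X0 e0.
apply: (@filterS _ (nbhs s) (nbhs_filter s) _ _ _ (nbhsx_ballx s delta delta0)) => r.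
rewrite -ball_normE /= in_itv/= => sr /andP[r0 r1].
exact: (dV sigma h sh (path_energy_le sh) st).
Qed.

Lemma path_integrable sigma h : speed_bound t sigma h -> sigma t = mu ->
  leb.-integrable `[0, t] (EFin \o (V \o sigma)).
Proof.
move=> sh st; apply: continuous_compact_integrable; first exact: segment_compact.
exact: path_continuous sh st.
Qed.

Lemma actionE (G : Pp d p -> R) sigma : AC t sigma -> sigma t = mu ->
  action G V t sigma = (G (sigma 0) +
    (p^-1 * fine (energy p t (metric_derivative t sigma)) -
     \int[leb]_(s in `[0, t]) V (sigma s)))%:E.
Proof.
move=> ACs st; have [smd _] := metric_derivativeP p1 HC t0 ACs.
have Vi := path_integrable smd st.
have [[mmd fmd] _] := smd.
have Ei : leb.-integrable `[0, t] (EFin \o (fun s => `|metric_derivative t sigma s| `^ p)).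
  apply/integrableP; split.
    apply/measurable_EFinP; apply: measurable_powR_comp.
    exact: measurableT_comp (@normr_measurable R setT) mmd.
  by under eq_integral do rewrite /= ger0_norm ?powR_ge0//.
rewrite /action EFinD; congr (_ + _)%E.
rewrite EFinB EFinM.
have -> : (fine (energy p t (metric_derivative t sigma)))%:E =
    (\int[leb]_(s in `[0%R, t]) (`|metric_derivative t sigma s| `^ p)%:E)%E.
  by rewrite fineK// ge0_fin_numE// energy_ge0.
rewrite -integralZl// [X in (_ - X)%E](_ : _ = \int[leb]_(s in `[0%R, t]) (V (sigma s))%:E)%E.
  rewrite -integralB//.
  - exact: integrableZl.
by rewrite fineK//; apply: integrable_fin_num => //.
Qed.

(** The change of centre goes through the Dirac mass at 0, that is, through the moment, and each of
    the two steps multiplies the leading term by [l ^ p]. Choosing [l] as the square root of 2 makes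
    the total exactly [2 ^ p], as the smallness condition allows; the rest goes into [K]. *)
Lemma Wp_pow_le_shift (rho : Pp d p) : exists K : R, forall nu : Pp d p,
  Wp nu rho `^ p <= 2 `^ p * Wp nu mu `^ p + K.
Proof.
pose l : R := Num.sqrt 2; pose c := (l / (l - 1)) `^ p.
have l1 : 1 < l by rewrite /l -[ltLHS]sqrtr1 ltr_sqrt// ltr1n.
exists (l `^ p * (c * moment mu) + c * moment rho) => nu'.
apply: le_trans (Wp_pow_le_moment p0 nu' rho l1) _; rewrite addrA lerD2r.
have -> : 2 `^ p = l `^ p * l `^ p.
  by rewrite -powRM ?sqrtr_ge0// -expr2 sqr_sqrtr.
have := ler_wpM2l (powR_ge0 l p) (moment_le_Wp p0 nu' mu l1).
by rewrite -/c mulrDr (mulrA (l `^ p) (l `^ p)).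
Qed.

End paths.

(** * Minimisation *)

Section minimisation.
Context (R : realType) (d : nat) (p : R) (p1 : 1 < p).
Context (C : R) (HC : poincare_constant d p C) (t : R) (t0 : 0 < t) (mu : Pp d p).
Context (V : Pp d p -> R) (V_narrow : narrow_continuous V).
Context (G : Pp d p -> R).
Local Notation leb := (@lebesgue_measure R).
Local Notation E sigma := (fine (energy p t (metric_derivative t sigma))).
Local Notation cost sigma := (G (sigma 0) +
  (p^-1 * E sigma - \int[leb]_(s in `[0, t]) V (sigma s))).
Implicit Types (sigma : R -> Pp d p) (h : R -> R).

Let p0 : 0 < p. Proof. exact: lt_trans ltr01 p1. Qed.

Let mI : measurable (`[0, t]%classic : set R).
Proof. exact: measurable_itv. Qed.

Let E_ge0 sigma : 0 <= E sigma.
Proof. exact/fine_ge0/energy_ge0. Qed.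

Lemma itv_cst_integrable (B : R) : leb.-integrable `[0, t] (EFin \o cst B).
Proof.
apply: measurable_bounded_integrable => //; first exact: leb_itv_fin.
exact: bounded_cst.
Qed.

Lemma itv_cst_Rintegral (B : R) : \int[leb]_(s in `[0, t]) (cst B s) = B * t.
Proof. by rewrite Rintegral_cst// leb_itv ?subr0// ltW. Qed.

Lemma integral_V_le (B kappa : R) sigma : AC t sigma -> sigma t = mu -> 0 < kappa ->
  (forall nu, V nu <= kappa * Wp nu mu `^ p + B) ->
  \int[leb]_(s in `[0, t]) V (sigma s) <= kappa * ((C * t) `^ p * E sigma) + B * t.
Proof.
move=> ACs st k0 VB; have [smd _] := metric_derivativeP p1 HC t0 ACs.
have Vi := path_integrable p1 V_narrow smd st.
have mV : measurable_fun `[0, t] (V \o sigma).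
  by apply/measurable_EFinP; exact: measurable_int Vi.
(* The comparison with the distance needs a nonnegative integrand, hence the positive part. *)
pose f s := Num.max 0 (V (sigma s) - B).
have mf : measurable_fun `[0, t] f.
  apply: measurable_maxr; first exact: measurable_cst.
  by apply: measurable_funB => //; exact: measurable_cst.
have f0 s : 0 <= f s by rewrite /f le_max lexx.
have fle : (\int[leb]_(s in `[0%R, t]) (f s)%:E <= (kappa * ((C * t) `^ p * E sigma))%:E)%E.
  (* [kappa] is extracted from the integral of the measurable [f], so that it never has to be moved
     across the integral of the distance. *)
  have -> : (\int[leb]_(s in `[0%R, t]) (f s)%:E =
      kappa%:E * \int[leb]_(s in `[0%R, t]) (kappa^-1 * f s)%:E)%E.
    rewrite -ge0_integralZl_EFin//.
    - by apply: eq_integral => s _; rewrite -EFinM mulrA divff ?gt_eqF// mul1r.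
    - by move=> s _; rewrite lee_fin mulr_ge0// invr_ge0 ltW.
    - by apply/measurable_EFinP; apply: measurable_funM => //; exact: measurable_cst.
    - exact: ltW.
  rewrite EFinM; apply: lee_wpmul2l; first by rewrite lee_fin ltW.
  apply: (@le_trans _ _ (\int[leb]_(s in `[0%R, t]) (Wp (sigma s) (sigma t) `^ p)%:E)%E).
    apply: le_integral_nonmeasurable => s _.
      by rewrite lee_fin mulr_ge0// invr_ge0 ltW.
    rewrite lee_fin ler_pdivrMl// /f ge_max mulr_ge0 ?powR_ge0 ?(ltW k0)//=.
    by rewrite lerBlDr st VB.
  apply: le_trans (poincare_energy p1 HC t0 ACs) _; rewrite EFinM.
  by apply: lee_wpmul2l; [rewrite lee_fin powR_ge0|exact: path_energy_le smd].
have fi : leb.-integrable `[0, t] (EFin \o f).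
  apply/integrableP; split; first exact/measurable_EFinP.
  under eq_integral do rewrite /= ger0_norm//.
  exact: le_lt_trans fle (ltry _).
apply: (@le_trans _ _ (\int[leb]_(s in `[0, t]) (f s + cst B s))).
  apply: le_Rintegral => //.
    rewrite (_ : EFin \o _ = (EFin \o f) \+ (EFin \o cst B))%E; last by apply/funext.
    by apply: integrableD => //; exact: itv_cst_integrable.
  by move=> s _; rewrite /f -lerBlDr le_max lexx orbT.
rewrite RintegralD//; last exact: itv_cst_integrable.
rewrite itv_cst_Rintegral lerD2r -lee_fin; apply: le_trans fle.
by rewrite fineK//; apply: integrable_fin_num.
Qed.

Lemma cost_lower_bound (L alpha beta : R) (rho : Pp d p) (T : R) :
  (forall m nu, `|G m - G nu| <= L * Wp m nu) ->
  (forall m, V m <= alpha * Wp m rho `^ p + beta) ->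
  t < T -> p * (2 * C * T) `^ p * alpha < 1 ->
  exists q K : R, 0 < q /\ forall sigma, AC t sigma -> sigma t = mu ->
    q * E sigma - K <= cost sigma.
Proof.
move=> GL Vg tT Tsmall; have [C0 _] := HC.
have T0 : 0 < T := lt_trans t0 tT.
pose D := (2 * C * T) `^ p.
have D0 : 0 < D by rewrite powR_gt0// !mulr_gt0.
(* [alpha] may be zero or negative, whereas the estimates multiply by it; the alternative
   [(2 * (p * D))^-1] is positive and gives [p * D * a = 1/2]. *)
have [a [a0 alpha_a aD]] : exists a, [/\ 0 < a, alpha <= a & p * D * a < 1].
  exists (Num.max alpha ((2 * (p * D))^-1)).
  have pD : 0 < p * D by rewrite mulr_gt0.
  split; [by rewrite lt_max invr_gt0 mulr_gt0 ?orbT|by rewrite le_max lexx|].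
  rewrite maxr_pMr ?(ltW pD)// gt_max Tsmall/= invfM mulrCA divff ?gt_eqF// mulr1.
  by rewrite invf_lt1// ltr1n.
have [K VK] := Wp_pow_le_shift p1 mu rho.
pose B := a * K + beta; pose kappa := a * 2 `^ p.
have k0 : 0 < kappa by rewrite mulr_gt0// powR_gt0.
have VB nu : V nu <= kappa * Wp nu mu `^ p + B.
  move: (VK nu) (Vg nu) (powR_ge0 (Wp nu rho) p); rewrite /B /kappa.
  move: (Wp nu rho `^ p) (Wp nu mu `^ p) (V nu) (2 `^ p) => w z v c wK vw w0.
  have := ler_wpM2l (ltW a0) wK; have := ler_wpM2r w0 alpha_a.
  by rewrite mulrDr mulrA; lra.
pose q := p^-1 - a * D.
have q0 : 0 < q by rewrite subr_gt0 -(ltr_pM2l p0) divff ?gt_eqF// mulrCA mulrC.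
have q20 : 0 < q / 2 by rewrite divr_gt0.
(* The Lipschitz term [|L| * Wp (sigma 0) mu] is at most a constant plus [|L| / l ^ (p - 1)] times
   the energy; this [l] limits it to half of [q]. *)
have [l l0 Ll] := exists_truncation p1 (normr_ge0 L) q20.
exists (q / 2), (- G mu + `|L| * (l * t) + B * t); split => // sigma ACs st.
have [smd _] := metric_derivativeP p1 HC t0 ACs.
have h1 := integral_V_le ACs st k0 VB.
have h2 : kappa * ((C * t) `^ p * E sigma) <= a * D * E sigma.
  rewrite mulrA ler_wpM2r// /kappa -mulrA ler_wpM2l ?(ltW a0)//.
  rewrite -powRM ?mulr_ge0 ?(ltW C0) ?(ltW t0)//; apply: ge0_ler_powR.
  - exact: ltW.
  - by rewrite nnegrE !mulr_ge0// ltW.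
  - by rewrite nnegrE !mulr_ge0// ltW.
  - by rewrite -mulrA ler_wpM2l// ler_wpM2l ?ltW.
have h3 : `|L| * Wp (sigma 0) (sigma t) <= `|L| * (l * t) + q / 2 * E sigma.
  apply: (@le_trans _ _ (`|L| * (l * t + E sigma / l `^ (p - 1)))).
    rewrite ler_wpM2l//.
    have := Wp_le_truncation p1 smd (path_energy_le smd) l0 (lexx 0) (ltW t0) (lexx t).
    by rewrite subr0.
  rewrite mulrDr lerD2l mulrCA mulrC; exact: ler_wpM2r.
have h4 : G mu - `|L| * Wp (sigma 0) (sigma t) <= G (sigma 0).
  have := GL (sigma 0) mu; rewrite -st => hG.
  have : L * Wp (sigma 0) (sigma t) <= `|L| * Wp (sigma 0) (sigma t).
    by rewrite ler_wpM2r ?Wp_ge0// ler_norm.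
  by move: hG; rewrite ler_norml => /andP[? _]; lra.
have -> : p^-1 * E sigma = q * E sigma + a * D * E sigma by rewrite /q; ring.
lra.
Qed.

End minimisation.

(** * Compactness of paths of bounded energy *)

Section limit_path.
Context (R : realType) (d : nat) (p : R) (p1 : 1 < p).
Context (C : R) (HC : poincare_constant d p C) (t : R) (t0 : 0 < t) (mu : Pp d p).
Context (V : Pp d p -> R) (V_narrow : narrow_continuous V).
Context (U : set_system nat) (UU : UltraFilter U).
Local Notation leb := (@lebesgue_measure R).
Local Notation E sigma := (fine (energy p t (metric_derivative t sigma))).

Let p0 : 0 < p. Proof. exact: lt_trans ltr01 p1. Qed.

Let mI : measurable (`[0, t]%classic : set R).
Proof. exact: measurable_itv. Qed.

Let E_ge0 (sigma : R -> Pp d p) : 0 <= E sigma.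
Proof. exact/fine_ge0/energy_ge0. Qed.

Context (sigma_ : nat -> R -> Pp d p) (X : R).
Context (AC_sigma : forall n, AC t (sigma_ n)).
Context (sigma_t : forall n, sigma_ n t = mu) (E_le : forall n, E (sigma_ n) <= X).

Let speed n : speed_bound t (sigma_ n) (metric_derivative t (sigma_ n)).
Proof. by case: (metric_derivativeP p1 HC t0 (AC_sigma n)). Qed.

Let energy_X n : (energy p t (metric_derivative t (sigma_ n)) <= X%:E)%E.
Proof. by apply: le_trans (path_energy_le (speed n)) _; rewrite lee_fin. Qed.

Let X0 : 0 <= X. Proof. exact: le_trans (E_ge0 _) (E_le 0%N). Qed.

Let M := 2 `^ p * (t + X) `^ p + 2 `^ p * moment mu.

Let moment_M n s : 0 <= s -> s <= t -> moment (sigma_ n s) <= M.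
Proof.
by move=> s0 st; rewrite /M -(sigma_t n); exact: moment_le_energy (speed n) (energy_X n) s0 st.
Qed.

(** At [s = t] the value is [mu] itself: a limit produced by compactness would only share its law,
    whereas admissibility asks for equality. *)
Let limits : exists sigma : R -> Pp d p, sigma t = mu /\
  forall s, 0 <= s -> s <= t ->
    narrow_limit U (fun n => sigma_ n s) (sigma s) /\ moment (sigma s) <= M.
Proof.
have h s : {a : Pp d p | (s = t -> a = mu) /\ (0 <= s -> s <= t ->
    narrow_limit U (fun n => sigma_ n s) a /\ moment a <= M)}.
  apply: cid; have [->|st] := eqVneq s t.
    exists mu; split => // _ _; split; last by rewrite -(sigma_t 0%N); apply: moment_M; [exact: ltW|].
    move=> f B _ _; rewrite (_ : (fun n => _) = cst (\int[mu]_z f z)); first exact: cvg_cst.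
    by apply/funext => n; rewrite sigma_t.
  have [/andP[s0 s1]|ns] := boolP ((0 <= s) && (s <= t)); last first.
    exists mu; split; first by [].
    by move=> s0 s1; move: ns; rewrite s0 s1.
  have [a aU aM] := narrow_compact p0 UU (fun n => moment_M n s0 s1).
  by exists a; split => // /eqP; rewrite (negbTE st).
exists (fun s => sval (h s)); split; first by have [+ _] := svalP (h t); apply.
by move=> s s0 s1; have [_] := svalP (h s); apply.
Qed.

Let c0 : R := lim ((fun n => E (sigma_ n)) @ U).

Let E_cvg : (fun n => E (sigma_ n)) @ U --> c0.
Proof.
apply: (@ultra_bounded_cvg R nat U UU _ 0 X) => n.
by rewrite E_ge0 E_le.
Qed.

Lemma limit_path_exists : exists sigma : R -> Pp d p, [/\ AC t sigma, sigma t = mu,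
  E sigma <= lim ((fun n => E (sigma_ n)) @ U) &
  forall s, 0 <= s -> s <= t -> narrow_limit U (fun n => sigma_ n s) (sigma s)].
Proof.
have [sigma [st slim]] := limits.
pose g n s := `|metric_derivative t (sigma_ n) s|.
have mg n : measurable_fun `[0, t] (g n).
  have [[mm _] _] := speed n.
  exact: measurableT_comp (@normr_measurable R setT) mm.
have g0 n (s : R) : `[0, t]%classic s -> 0 <= g n s by move=> _; exact: normr_ge0.
have [h [h0 hi hlim]] := @limit_density _ _ R leb `[0, t]%classic mI (leb_itv_fin 0 t)
  nat U UU p p1 X g mg g0 energy_X.
have hlim' (A : set R) : measurable A ->
    (fun n => \int[leb]_(x in `[0, t] `&` A) g n x) @ U -->
    \int[leb]_(x in `[0, t] `&` A) h x.
  move=> mA; have mIA : measurable (`[0, t]%classic `&` A) by exact: measurableI.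
  by have := hlim _ mIA; rewrite setIA setIid.
have hE : (energy p t h <= c0%:E)%E.
  rewrite /energy; under eq_integral do rewrite ger0_norm//.
  by apply: (@weak_limit_powR_le _ _ R leb `[0, t]%classic mI (leb_itv_fin 0 t)
      nat U UU p p1 g mg g0 _ _ E_cvg) => // n;
    exact: path_energy_le.
have sh : speed_bound t sigma h.
  split.
    split; last exact: le_lt_trans hE (ltry _).
    by apply: measurable_funTS; apply/measurable_EFinP; exact: measurable_int hi.
  move=> s1 s2 s10 s12 s2t.
  have s20 := le_trans s10 s12; have s1t := le_trans s12 s2t.
  have mJ : measurable (`[s1, s2]%classic : set R) by exact: measurable_itv.
  have IJ : `[0, t] `&` `[s1, s2] = `[s1, s2]%classic.
    apply/setIidPr => s; rewrite /= !in_itv/= => /andP[a b].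
    by rewrite (le_trans s10 a) (le_trans b s2t).
  have := hlim' _ mJ; rewrite IJ => gh.
  have [lim1 _] := slim s1 s10 s1t; have [lim2 _] := slim s2 s20 s2t.
  have H0 : 0 <= \int[leb]_(x in `[s1, s2]) h x by apply: Rintegral_ge0.
  have Wn n : Wp (sigma_ n s1) (sigma_ n s2) `^ p <=
      `|\int[leb]_(x in `[s1, s2]) g n x| `^ p.
    have [_ Wg] := speed_bound_norm p1 (speed n).
    apply: ge0_ler_powR; rewrite ?nnegrE ?Wp_ge0 ?(ltW p0)//.
    exact: le_trans (Wg s1 s2 s10 s12 s2t) (ler_norm _).
  (* Lower semicontinuity is stated for [p]-th powers; the bounds are raised to the power [p] for
     the limit, and strict monotonicity of the power undoes this at the end. *)
  have cp : {for \int[leb]_(x in `[s1, s2]) h x, continuous (fun a : R => `|a| `^ p)}.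
    exact: norm_powR_continuous.
  have gp : (fun n => `|\int[leb]_(x in `[s1, s2]) g n x| `^ p) @ U -->
      `|\int[leb]_(x in `[s1, s2]) h x| `^ p by exact: continuous_cvg _ cp gh.
  have := Wp_narrow_lsc p0 UU lim1 lim2 (fun n => moment_M n s10 s1t)
    (fun n => moment_M n s20 s2t) Wn gp.
  rewrite (ger0_norm H0).
  move: (Wp_ge0 (sigma s1) (sigma s2)) H0.
  move: (Wp _ _) (\int[leb]_(x in _) _) => x y x_ge0 y_ge0 xy.
  have [//|yx] := leP x y; move: xy; rewrite leNgt gt0_ltr_powR//.
exists sigma; split; [by exists h|exact: st| |].
- rewrite -/c0 -lee_fin; apply: le_trans hE.
  apply: le_trans (energy_metric_derivative_le p1 HC t0 sh).
  have [smd _] := metric_derivativeP p1 HC t0 (ex_intro _ h sh : AC t sigma).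
  by rewrite fineK// ge0_fin_numE ?energy_ge0//; case: smd => -[].
- by move=> s s0 s1; case: (slim s s0 s1).
Qed.

(* Equicontinuity turns pointwise convergence of [V] along the paths into
   uniform convergence. *)
Lemma integral_V_cvg sigma : AC t sigma -> sigma t = mu -> E sigma <= X ->
  (forall s, 0 <= s -> s <= t -> narrow_limit U (fun n => sigma_ n s) (sigma s)) ->
  (fun n => \int[leb]_(s in `[0, t]) V (sigma_ n s)) @ U -->
  \int[leb]_(s in `[0, t]) V (sigma s).
Proof.
move=> ACs st EX slim.
have [smd _] := metric_derivativeP p1 HC t0 ACs.
have smdX : (energy p t (metric_derivative t sigma) <= X%:E)%E.
  by apply: le_trans (path_energy_le smd) _; rewrite lee_fin.
apply/cvgrPdist_le => e e0.
(* Three errors are to come: one at a grid point and, by equicontinuity, one along each of the two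
   paths. Dividing by [t] accounts for the length of the interval. *)
have e3 : 0 < e / t / 3 by rewrite !divr_gt0.
have [delta delta0 dV] := equicontinuous_along_paths p1 t mu V_narrow X0 e3.
pose N := Num.truncn (t / delta).
have N0 : 0 < N.+1%:R :> R by rewrite ltr0n.
have tN : t / N.+1%:R < delta by rewrite ltr_pdivrMr// -ltr_pdivrMl// mulrC truncnS_gt.
(* A grid of mesh below [delta] containing both ends: for [s = t] the grid point to the left is the
   one of index [N.+1], hence [N.+2] points. Being finite in number, they admit one common set of
   indices in [U]. *)
pose r (j : 'I_N.+2) : R := j%:R * (t / N.+1%:R).
have tN0 : 0 < t / N.+1%:R by rewrite divr_gt0.
have r0 j : 0 <= r j by rewrite mulr_ge0// ltW.
have rt j : r j <= t.
  rewrite /r mulrA ler_pdivrMr// mulrC ler_pM2l// ler_nat -ltnS; exact: ltn_ord.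
have near_r j : U [set n | `|V (sigma_ n (r j)) - V (sigma (r j))| < e / t / 3].
  have := narrow_limit_continuous UU V_narrow (slim (r j) (r0 j) (rt j)).
  move=> /cvgrPdist_lt/(_ _ e3); apply: filterS => n /=.
  by rewrite distrC.
have FU : Filter U by exact: _.
apply: (@filterS _ U FU _ _ _ (filter_forall FU near_r)) => n Hn.
have Vi := path_integrable p1 V_narrow smd st.
have Vni := path_integrable p1 V_narrow (speed n) (sigma_t n).
have close s : 0 <= s -> s <= t -> `|V (sigma s) - V (sigma_ n s)| <= e / t.
  move=> s0 s1; pose k := Num.truncn (s / (t / N.+1%:R)).
  have sk0 : 0 <= s / (t / N.+1%:R) by rewrite divr_ge0// ltW.
  have kN : (k < N.+2)%N.
    rewrite -(ltr_nat R); apply: (@le_lt_trans _ _ N.+1%:R); last by rewrite ltr_nat.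
    apply: (@le_trans _ _ (s / (t / N.+1%:R))); first by rewrite truncn_le.
    by rewrite ler_pdivrMr// mulrC divfK ?gt_eqF.
  pose j := Ordinal kN.
  have srj : `|s - r j| < delta.
    have k1 : k%:R * (t / N.+1%:R) <= s by rewrite -ler_pdivlMr// truncn_le.
    have k2 : s < k.+1%:R * (t / N.+1%:R) by rewrite -ltr_pdivrMr// truncnS_gt.
    rewrite /r /= ger0_norm ?subr_ge0//; apply: lt_trans tN.
    by rewrite ltrBlDl -[X in _ + X]mul1r -mulrDl natr1.
  have v1 := dV sigma _ smd smdX st s (r j) s0 s1 (r0 j) (rt j) srj.
  have v2 := dV (sigma_ n) _ (speed n) (energy_X n) (sigma_t n) s (r j) s0 s1 (r0 j) (rt j) srj.
  have v3 : `|V (sigma_ n (r j)) - V (sigma (r j))| < e / t / 3 := Hn j.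
  move: v1 v2 v3; move: (V (sigma s)) (V (sigma_ n s)) (V (sigma (r j)))
    (V (sigma_ n (r j))) => a b c d'.
  rewrite !ltr_norml ler_norml => /andP[? ?] /andP[? ?] /andP[? ?].
  by apply/andP; split; lra.
have Di : leb.-integrable `[0, t] (EFin \o (fun s => V (sigma s) - V (sigma_ n s))).
  rewrite (_ : EFin \o _ = (EFin \o (V \o sigma)) \- (EFin \o (V \o sigma_ n)))%E;
    last by apply/funext.
  exact: integrableB.
rewrite -RintegralB//; apply: le_trans (le_normr_Rintegral _ Di) _ => //.
have -> : e = \int[leb]_(s in `[0, t]) (cst (e / t) s).
  by rewrite itv_cst_Rintegral// divfK ?gt_eqF.
apply: le_Rintegral => //.
- exact: (integrable_norm Di).
- exact: itv_cst_integrable.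
- by move=> s; rewrite /= in_itv/= => /andP[s0 s1]; exact: close.
Qed.

End limit_path.

Lemma AC_cst (R : realType) (d : nat) (p t : R) (mu : Pp d p) :
  0 < p -> AC t (fun=> mu).
Proof.
move=> p0; exists (cst 0); split.
  split; first exact: measurable_cst.
  under eq_integral do rewrite /= normr0 powR0 ?gt_eqF//.
  by rewrite integral0.
move=> s1 s2 _ _ _; rewrite Wp_refl//.
by apply: Rintegral_ge0.
Qed.

Lemma action0 (R : realType) (d : nat) (p : R) (G V : Pp d p -> R) (sigma : R -> Pp d p) :
  action G V 0 sigma = (G (sigma 0))%:E.
Proof. by rewrite /action set_itv1 integral_set1 adde0. Qed.

Theorem corollary4p3 (R : realType) (d : nat) (p : R) (p_gt1 : 1 < p)
    (Cp : R) (HCp : poincare_constant d p Cp)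
    (G V : Pp d p -> R)
    (G_cont : Wp_continuous G) (V_cont : Wp_continuous V)
    (G_lip : Wp_lipschitz G)
    (alpha beta : R) (rho : Pp d p)
    (V_growth : forall mu : Pp d p, V mu <= alpha * Wp mu rho `^ p + beta)
    (G_narrow : narrow_continuous G) (V_narrow : narrow_continuous V)
    (T : R) (T_gt0 : 0 < T) (T_small : p * (2 * Cp * T) `^ p * alpha < 1)
    (mu : Pp d p) (t : R) (t_ge0 : 0 <= t) (t_ltT : t < T) :
  exists2 sigma : R -> Pp d p,
    admissible mu t sigma & action G V t sigma = value G V mu t.
Proof.
have p0 : 0 < p := lt_trans ltr01 p_gt1.
have cst_adm : admissible mu t (fun=> mu) by split; first exact: AC_cst.
(* The Poincare inequality assumes a positive time. At [t = 0] every admissible path has action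
   [G mu]. *)
move: t_ge0; rewrite le_eqVlt => /orP[/eqP t0|t0].
  exists (fun=> mu) => //; apply/eqP; rewrite eq_le; apply/andP; split.
    apply: le_ereal_inf_tmp => _ [sigma [_ st] <-].
    by rewrite -t0 in st *; rewrite !action0 st.
  by apply: ereal_inf_lbound; exists (fun=> mu).
have [L GL] := G_lip.
have [q [K [q0 qK]]] := cost_lower_bound p_gt1 HCp t0 mu V_narrow GL V_growth t_ltT T_small.
pose E (sigma : R -> Pp d p) := fine (energy p t (metric_derivative t sigma)).
have E0 (sigma : R -> Pp d p) : 0 <= E sigma by exact/fine_ge0/energy_ge0.
pose cost (sigma : R -> Pp d p) := G (sigma 0) +
  (p^-1 * E sigma - \int[@lebesgue_measure R]_(s in `[0, t]) V (sigma s)).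
have costE (sigma : R -> Pp d p) : AC t sigma -> sigma t = mu ->
  action G V t sigma = (cost sigma)%:E by exact: (actionE p_gt1 HCp t0 V_narrow).
(* Coercivity bounds the value below by [- K], as energies are nonnegative; the constant path bounds
   it above. *)
have [v vE] : exists v, value G V mu t = v%:E.
  exists (fine (value G V mu t)); rewrite fineK// fin_real//; apply/andP; split.
    apply: (@lt_le_trans _ _ (- K)%:E); first exact: ltNyr.
    apply: le_ereal_inf_tmp => _ [sigma [ACs st] <-]; rewrite costE// lee_fin.
    apply: le_trans (qK sigma ACs st); rewrite lerDr.
    by apply: mulr_ge0; [exact: ltW|exact: E0].
  apply: (@le_lt_trans _ _ (action G V t (fun=> mu))).
    by apply: ereal_inf_lbound; exists (fun=> mu).
  by case: cst_adm => ? ?; rewrite costE// ltry.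
have min n : {sigma : R -> Pp d p | admissible mu t sigma /\ cost sigma <= v + n.+1%:R^-1}.
  apply: cid; have n0 : 0 < n.+1%:R^-1 :> R by rewrite invr_gt0.
  have vfin : value G V mu t \is a fin_num by rewrite vE.
  have [_ [sigma [ACs st] <-]] := lb_ereal_inf_adherent n0 vfin.
  rewrite -/(value G V mu t) vE costE// -EFinD lte_fin => /ltW ?.
  by exists sigma.
pose sigma_ n := sval (min n).
have ACn n : AC t (sigma_ n) by case: (svalP (min n)) => -[].
have sn n : sigma_ n t = mu by case: (svalP (min n)) => -[].
have costn n : cost (sigma_ n) <= v + n.+1%:R^-1 by case: (svalP (min n)).
(* Solves [q * E - K <= v + 1] for the energy. *)
pose X := (v + 1 + K) / q.
have EX n : E (sigma_ n) <= X.
  rewrite ler_pdivlMr// mulrC -lerBlDr; apply: le_trans (qK _ (ACn n) (sn n)) _.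
  by apply: le_trans (costn n) _; rewrite lerD2l invf_le1// ler1n.
have [U UU sU] := nat_ultrafilter.
have [sigma [ACs st Elim slim]] := limit_path_exists p_gt1 HCp t0 UU ACn sn EX.
have Ecvg : (fun n => E (sigma_ n)) @ U --> lim ((fun n => E (sigma_ n)) @ U).
  by apply: (@ultra_bounded_cvg R nat U UU _ 0 X) => n; rewrite E0 EX.
have EsX : E sigma <= X.
  apply: le_trans Elim _.
  exact: (le_filter_lim Ecvg (cvg_cst X)).
have Vcvg := integral_V_cvg p_gt1 HCp t0 V_narrow UU ACn sn EX ACs st EsX slim.
have Gcvg := narrow_limit_continuous UU G_narrow (slim 0 (lexx 0) (ltW t0)).
exists sigma => //; apply/eqP; rewrite eq_le; apply/andP; split; last first.
  by apply: ereal_inf_lbound; exists sigma.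
rewrite vE costE// lee_fin.
(* Along [U] the costs converge to an expression with the limit of the energies in place of the
   energy of [sigma], which is no larger. *)
have costcvg : (fun n => cost (sigma_ n)) @ U --> G (sigma 0) +
    (p^-1 * lim ((fun n => E (sigma_ n)) @ U) -
     \int[@lebesgue_measure R]_(s in `[0, t]) V (sigma s)).
  exact: (cvgD Gcvg (cvgB (cvgM (cvg_cst p^-1) Ecvg) Vcvg)).
have vcvg : (fun n => v + n.+1%:R^-1) @ U --> v + 0.
  exact: (cvgD (cvg_cst v) (cvg_nat_ultra sU (@cvg_succ_inv R))).
rewrite -[v]addr0; apply: le_trans (le_filter_lim costcvg vcvg costn).
by rewrite /cost lerD2l lerD2r ler_wpM2l// invr_ge0 ltW.
Qed.
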